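(* Let $k$ be a positive integer and let $\Lambda$ be a fundamental weight of type $A_k^{(1)}$. Then $D_\Lambda$ restricts to a derivation of the affine Fomin–Stanley subalgebra $\mathbb{B}$: for all $x,y\in\mathbb{B}$, $$D_\Lambda(xy) = D_\Lambda(x)\,y + x\,D_\Lambda(y).$$ In particular $D_\Lambda(\mathbb{B})\subset\mathbb{B}$.
   Context: $I=\{0,1,\dots,k\}$; $i,j\in I$ are adjacent if $i-j\equiv\pm1\pmod{k+1}$. $W$ is the affine symmetric group generated by $s_i$ ($i\in I$) with $s_i^2=1$, $s_is_j=s_js_i$ for non-adjacent $i,j$, $s_is_js_i=s_js_is_j$ for adjacent $i,j$; $\ell$ is length. Root datum of type $A_k^{(1)}$: simple coroots $\alpha_i^\vee$, simple roots $\alpha_i$, pairing with $\langle\alpha_i^\vee,\alpha_j\rangle=2,-1,0$ according as $i=j$, adjacent, otherwise; $W$ acts by $s_i(\lambda)=\lambda-\langle\alpha_i^\vee,\lambda\rangle\alpha_i$, $s_i(\mu)=\mu-\langle\mu,\alpha_i\rangle\alpha_i^\vee$. Fundamental weights: $\langle\alpha_i^\vee,\Lambda_j\rangle=\delta_{ij}$. For a Bruhat cover $v\lessdot w$, $v^{-1}w=us_iu^{-1}$, $\alpha_{v,w}=u(\alpha_i)$ is the positive real root with $s_{\alpha_{v,w}}=v^{-1}w$ and $\alpha^\vee_{v,w}=u(\alpha_i^\vee)$. $\mathbb{A}$ is the nilCoxeter algebra over $\mathbb{Q}$ with generators $\mathbf{u}_i$ ($i\in I$), relations $\mathbf{u}_i^2=0$,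 $\mathbf{u}_i\mathbf{u}_j=\mathbf{u}_j\mathbf{u}_i$ (non-adjacent), $\mathbf{u}_i\mathbf{u}_j\mathbf{u}_i=\mathbf{u}_j\mathbf{u}_i\mathbf{u}_j$ (adjacent), and basis $\mathbf{u}_w$ ($w\in W$), $\mathbf{u}_w$ the product along any reduced word of $w$. $D_\Lambda$ is the linear map $D_\Lambda(\mathbf{u}_w)=\sum_{v\lessdot w}\langle\alpha^\vee_{v,w},\Lambda\rangle\mathbf{u}_v$. For $S\subsetneq I$, $w_S$ is the unique element of $W$ whose reduced words use each letter of $S$ exactly once and have $s_{j+1}$ before $s_j$ whenever $j,j+1\in S$ (mod $k+1$); $\mathbf{h}_i=\sum_{|S|=i}\mathbf{u}_{w_S}$ for $0\le i\le k$. The affine Fomin–Stanley subalgebra $\mathbb{B}$ is the subalgebra of $\mathbb{A}$ generated by $\mathbf{h}_1,\dots,\mathbf{h}_k$ (these commute and are algebraically independent).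
   Formalization: For k = 1 the stated relations would give S_3 and a false claim (D(h_1^2) ≠ 2h_1), so there the genuine type A_1^{(1)} data are used: off-diagonal pairings are −2 and no braid relation is imposed in W or in the nilCoxeter algebra; k ≥ 2 is as stated. *)

(* Defs.v *)
From HB Require Import structures.
From mathcomp Require Import all_boot all_order all_algebra.
From mathcomp Require Import finmap boolp classical_sets cardinality fsbigop.
From mathcomp Require Import zify ring.
From mathcomp Require Import monalg.

Set Implicit Arguments.
Unset Strict Implicit.
Unset Printing Implicit Defensive.

Import GRing.Theory Num.Theory.
Local Open Scope quotient_scope.
Local Open Scope ring_scope.

Section MonoidAlgebra.

Variables (R : comNzRingType) (K : monomType).
Implicit Types g : {malg R[K]}.

Lemma malg_scalerAr c g1 g2 : c *: (g1 * g2) = g1 * (c *: g2).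
Proof.
apply/malgP => m; rewrite mcoeffZ (malgMEw (fsubset_refl _) (fsubset_refl _)).
rewrite (malgMEw (fsubset_refl _) (msuppZ_le c g2)) !raddf_sum mulr_sumr /=.
apply: eq_bigr => k1 _; rewrite !raddf_sum mulr_sumr /=; apply: eq_bigr => k2 _.
by rewrite !mcoeffU mcoeffZ mulrCA mulrnAr.
Qed.

End MonoidAlgebra.

Section LinearExtension.

Variables (R : nzRingType) (K : choiceType) (V : lmodType R) (h : K -> V).

Definition malg_lin (g : {malg R[K]}) : V := \sum_(m <- msupp g) g@_m *: h m.

Lemma malg_linEw (d : {fset K}) g :
  (msupp g `<=` d)%fset -> malg_lin g = \sum_(m <- d) g@_m *: h m.
Proof.
move=> sgd; apply: big_fset_incl sgd _ => m _ /mcoeff_outdom->.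
exact: scale0r.
Qed.

Lemma malg_lin_is_linear : linear malg_lin.
Proof.
move=> c g1 g2; pose d := (msupp g1 `|` msupp g2)%fset.
rewrite (@malg_linEw d g1) ?fsubsetUl // (@malg_linEw d g2) ?fsubsetUr //.
rewrite (@malg_linEw d).
  rewrite scaler_sumr -big_split; apply: eq_bigr => m _ /=.
  by rewrite mcoeffD mcoeffZ scalerDl scalerA.
by apply: fsubset_trans (msuppD_le _ _) (fsetSU _ (msuppZ_le _ _)).
Qed.

HB.instance Definition _ :=
  GRing.isLinear.Build R {malg R[K]} V *:%R malg_lin malg_lin_is_linear.

Lemma malg_linU c m : malg_lin << c *g m >> = c *: h m.
Proof. by rewrite (malg_linEw msuppU_le) big_seq_fset1 mcoeffUU. Qed.

End LinearExtension.

Section AffineTypeA.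

Variable k : nat.

Local Notation I := 'I_k.+1.

(* [ordS i] is i + 1 modulo k + 1. *)
Definition adj (i j : I) : bool := (i == ordS j) || (j == ordS i).

(* For k >= 2 this has entries 2, -1, 0.  For k = 1 both off-diagonal entries
   are -2, as they must be in type A_1^(1), where i - j = 1 and i - j = -1 hold
   simultaneously. *)
Definition cartan (i j : I) : int :=
  if i == j then 2 else - ((i == ordS j)%:R + (j == ordS i)%:R).

(* Generators and relations of the affine symmetric group, on words.  There is
   no braid relation for k = 1 (infinite dihedral group). *)
Inductive cox_eq : seq I -> seq I -> Prop :=
| cox_refl a : cox_eq a a
| cox_sym a b : cox_eq a b -> cox_eq b a
| cox_trans a b c : cox_eq a b -> cox_eq b c -> cox_eq a c
| cox_cat a b c d : cox_eq a b -> cox_eq c d -> cox_eq (a ++ c) (b ++ d)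
| cox_invol i : cox_eq [:: i; i] [::]
| cox_comm i j : ~~ adj i j -> cox_eq [:: i; j] [:: j; i]
| cox_braid i j : (1 < k)%N -> i != j -> adj i j ->
    cox_eq [:: i; j; i] [:: j; i; j].

Definition cox_rel (a b : seq I) : bool := `[< cox_eq a b >].

Lemma cox_rel_equiv : equiv_class_of cox_rel.
Proof.
split=> [a|a b|b a c].
- exact/asboolP/cox_refl.
- by apply/asboolP/asboolP; apply: cox_sym.
- by move=> /asboolP ab /asboolP bc; apply/asboolP/(cox_trans ab bc).
Qed.

Canonical cox_rel_canonical := EquivRelPack cox_rel_equiv.

Definition affW := {eq_quot cox_rel}.

HB.instance Definition _ : EqQuotient _ cox_rel affW := EqQuotient.on affW.
HB.instance Definition _ := Choice.on affW.

Definition wcls (a : seq I) : affW := \pi_affW a.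

Lemma wclsP a b : wcls a = wcls b <-> cox_eq a b.
Proof. by split=> [/eqquotP/asboolP|?] //; apply/eqquotP/asboolP. Qed.

Lemma wcls_repr w : wcls (repr w) = w. Proof. exact: reprK. Qed.

Definition affW_one : affW := wcls [::].
Definition affW_mul : affW -> affW -> affW :=
  locked (fun v w => wcls (repr v ++ repr w)).
Definition affW_inv : affW -> affW := locked (fun w => wcls (rev (repr w))).

Lemma repr_cox a : cox_eq (repr (wcls a)) a.
Proof. by apply/wclsP; rewrite wcls_repr. Qed.

Lemma affW_mulE a b : affW_mul (wcls a) (wcls b) = wcls (a ++ b).
Proof.
by rewrite /affW_mul -lock; apply/wclsP/cox_cat; apply: repr_cox.
Qed.

Lemma cox_rev a b : cox_eq a b -> cox_eq (rev a) (rev b).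
Proof.
elim=> {a b} [a|a b _|a b c _ ab _|a b c d _ ab _ cd|i|i j ij|i j k1 ij aij].
- exact: cox_refl.
- exact: cox_sym.
- exact: cox_trans.
- by rewrite !rev_cat; apply: cox_cat.
- exact: cox_invol.
- exact/cox_sym/cox_comm.
- exact: cox_braid.
Qed.

Lemma affW_invE a : affW_inv (wcls a) = wcls (rev a).
Proof. by rewrite /affW_inv -lock; apply/wclsP/cox_rev/repr_cox. Qed.

Lemma cox_revV a : cox_eq (rev a ++ a) [::].
Proof.
elim: a => [|i a IH]; first exact: cox_refl.
rewrite rev_cons cat_rcons; apply: cox_trans IH.
apply: (cox_cat (cox_refl _)).
by apply: (cox_cat (cox_invol i) (cox_refl a)).
Qed.

Lemma affW_mulA : associative affW_mul.
Proof.
move=> u v w; rewrite -(wcls_repr u) -(wcls_repr v) -(wcls_repr w).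
by rewrite !affW_mulE catA.
Qed.

Lemma affW_mul1w : left_id affW_one affW_mul.
Proof. by move=> w; rewrite -(wcls_repr w) affW_mulE. Qed.

Lemma affW_mulw1 : right_id affW_one affW_mul.
Proof. by move=> w; rewrite -(wcls_repr w) affW_mulE cats0. Qed.

Lemma affW_mulVw : left_inverse affW_one affW_inv affW_mul.
Proof.
move=> w; rewrite -(wcls_repr w) affW_invE affW_mulE.
exact/wclsP/cox_revV.
Qed.

Lemma affW_mulwV : right_inverse affW_one affW_inv affW_mul.
Proof.
move=> w; rewrite -(wcls_repr w) affW_invE affW_mulE -{1}(revK (repr w)).
exact/wclsP/cox_revV.
Qed.

HB.instance Definition _ := isGroup.Build affW
  affW_mulA affW_mul1w affW_mulw1 affW_mulVw affW_mulwV.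

Lemma mulg_repr (v w : affW) : (v * w)%g = wcls (repr v ++ repr w).
Proof. by rewrite -affW_mulE !wcls_repr. Qed.

Definition sgen (i : I) : affW := wcls [:: i].

Definition wprod (a : seq I) : affW := (\prod_(i <- a) sgen i)%g.

Lemma wprodE a : wprod a = wcls a.
Proof.
rewrite /wprod; elim: a => [|i a IH]; first by rewrite big_nil.
by rewrite big_cons IH; apply: affW_mulE.
Qed.

Lemma len_subproof w : exists n, `[< exists a, size a = n /\ wprod a = w >].
Proof.
by exists (size (repr w)); apply/asboolP; exists (repr w); rewrite wprodE wcls_repr.
Qed.

Definition len (w : affW) : nat := ex_minn (len_subproof w).

Definition reduced_word (w : affW) (a : seq I) : bool :=
  (size a == len w) && (wprod a == w).

Lemma redword_subproof w : exists a, reduced_word w a.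
Proof.
rewrite /reduced_word /len; case: ex_minnP => n /asboolP[a [<- <-]] _.
by exists a; rewrite !eqxx.
Qed.

Definition redword (w : affW) : seq I := xchoose (redword_subproof w).

Lemma redwordP w : reduced_word w (redword w).
Proof. exact: xchooseP. Qed.

Lemma len_le a : (len (wprod a) <= size a)%N.
Proof.
by rewrite /len; case: ex_minnP => n _; apply; apply/asboolP; exists a.
Qed.

(* Root datum.  A row vector is a combination of the simple coroots, a column
   vector of roots is a combination of the simple roots, and a column vector of
   weights is a combination of the fundamental weights. *)
Definition alphav (i : I) : 'rV[int]_k.+1 := delta_mx 0 i.
Definition alpha (i : I) : 'cV[int]_k.+1 := delta_mx i 0.
Definition fund (i : I) : 'cV[int]_k.+1 := delta_mx i 0.

Definition pair_root (mu : 'rV[int]_k.+1) (lam : 'cV[int]_k.+1) : int :=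
  (mu *m \matrix_(i, j) cartan i j *m lam) 0 0.
Definition pair_weight (mu : 'rV[int]_k.+1) (L : 'cV[int]_k.+1) : int :=
  (mu *m L) 0 0.

Definition refl_root (i : I) (lam : 'cV[int]_k.+1) :=
  lam - pair_root (alphav i) lam *: alpha i.
Definition refl_coroot (i : I) (mu : 'rV[int]_k.+1) :=
  mu - pair_root mu (alpha i) *: alphav i.

Definition act_root (w : affW) (lam : 'cV[int]_k.+1) :=
  foldr refl_root lam (repr w).
Definition act_coroot (w : affW) (mu : 'rV[int]_k.+1) :=
  foldr refl_coroot mu (repr w).

Lemma pair_rootE i j : pair_root (alphav i) (alpha j) = cartan i j.
Proof. by rewrite /pair_root -rowE -colE !mxE. Qed.

Lemma pair_weightE i j : pair_weight (alphav i) (fund j) = (i == j)%:R.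
Proof. by rewrite /pair_weight -rowE !mxE eqxx andbT. Qed.

Lemma cartanC i j : cartan i j = cartan j i.
Proof. by rewrite /cartan eq_sym addrC. Qed.

Lemma cartan_nonadj i j : i != j -> ~~ adj i j -> cartan i j = 0.
Proof.
by rewrite /cartan /adj => /negPf-> /norP[/negPf-> /negPf->]; rewrite addr0 oppr0.
Qed.

Lemma cartan_adj i j : (1 < k)%N -> i != j -> adj i j -> cartan i j = -1.
Proof.
rewrite /cartan /adj => k1 /negPf-> /orP aij.
suff: ~~ ((i == ordS j) && (j == ordS i)).
  by case: aij => ->; [case: (j == _) | case: (i == _)].
apply/negP => /andP[/eqP eij /eqP eji]; move: (congr1 val eij) (congr1 val eji).
rewrite /= => {eij eji aij}; have := ltn_ord i; have := ltn_ord j.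
rewrite !ltnS => jk ik.
have [{}jk|{}jk|ej] := ltngtP j k; last 1 first.
- rewrite ej modnn => ei; rewrite ei modn_small ?ltnS; lia.
- rewrite modn_small ?ltnS // => ei.
  have [{}ik|{}ik|ek] := ltngtP i k; last by rewrite ek modnn; lia.
    by rewrite modn_small ?ltnS //; lia.
  lia.
- lia.
Qed.

Section Reflections.

Variables (V : lmodType int) (e : I -> V) (p : I -> V -> int).
Hypothesis pB : forall i c x y, p i (x - c *: y) = p i x - c * p i y.
Hypothesis pE : forall i j, p i (e j) = cartan i j.

Let r i x := x - p i x *: e i.

Lemma refl_cox a b x : cox_eq a b -> foldr r x a = foldr r x b.
Proof.
move=> ab; elim: ab x
  => {a b} [a|a b _ IH|a b c _ IH1 _ IH2|a b c d _ IH1 _ IH2|i|i j ij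
           |i j k1 ij aij] x //.
- by rewrite IH1.
- by rewrite !foldr_cat IH2 IH1.
- rewrite /= /r pB pE /cartan eqxx -addrA -opprD -scalerDl.
  have -> : p i x + (p i x - p i x * 2) = 0 by ring.
  by rewrite scale0r subr0.
- have [->//|nij] := eqVneq i j.
  have cij := cartan_nonadj nij ij; have cji := cij; rewrite cartanC in cji.
  by rewrite /= /r !pB !pE cij cji !mulr0 !subr0 addrAC.
- have cij := cartan_adj k1 ij aij; have cji := cij; rewrite cartanC in cji.
  have mrg c c' d u v : x - c *: u - d *: v - c' *: u = x - (c + c') *: u - d *: v.
    by rewrite scalerDl opprD addrA [X in X = _]addrAC.
  rewrite /= /r !pB !pE cij cji /cartan !eqxx !mrg [RHS]addrAC.
  by congr (_ - _ *: _ - _ *: _); ring.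
Qed.

End Reflections.

Lemma refl_root_cox a b lam :
  cox_eq a b -> foldr refl_root lam a = foldr refl_root lam b.
Proof.
apply: refl_cox => [i c x y|i j]; last exact: pair_rootE.
by rewrite /pair_root mulmxBr -scalemxAr !mxE.
Qed.

Lemma refl_coroot_cox a b mu :
  cox_eq a b -> foldr refl_coroot mu a = foldr refl_coroot mu b.
Proof.
apply: (refl_cox (p := fun i mu => pair_root mu (alpha i))) => [i c x y|i j].
  by rewrite /pair_root !mulmxBl -!scalemxAl !mxE.
by rewrite pair_rootE cartanC.
Qed.

Lemma act_root_sgen i lam : act_root (sgen i) lam = refl_root i lam.
Proof. exact: (refl_root_cox _ (repr_cox [:: i])). Qed.

Lemma act_coroot_sgen i mu : act_coroot (sgen i) mu = refl_coroot i mu.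
Proof. exact: (refl_coroot_cox _ (repr_cox [:: i])). Qed.

Lemma act_rootM v w lam :
  act_root (v * w)%g lam = act_root v (act_root w lam).
Proof.
by rewrite /act_root mulg_repr (refl_root_cox _ (repr_cox _)) foldr_cat.
Qed.

Lemma act_corootM v w mu :
  act_coroot (v * w)%g mu = act_coroot v (act_coroot w mu).
Proof.
by rewrite /act_coroot mulg_repr (refl_coroot_cox _ (repr_cox _)) foldr_cat.
Qed.

(* Covers of the (strong) Bruhat order. *)
Definition cover (v w : affW) : Prop :=
  len w = (len v).+1 /\ exists u i, (v^-1 * w = u * sgen i * u^-1)%g.

Lemma finite_covers w : finite_set [set v | cover v w]%classic.
Proof.
pose f (t : (len w).-tuple I) := wprod (behead t).
apply: (sub_finite_set _ (finite_image f (@finite_finset _ setT))) => /=.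
move=> v /= [lw _]; have /andP[/eqP sv /eqP vE] := redwordP v.
have sz : size (ord0 :: redword v) == len w by rewrite /= sv lw.
by exists (Tuple sz).
Qed.

(* The coroot u(alpha_i^vee) for any u and i such that v^-1 w = u s_i u^-1 and
   u(alpha_i) is a positive root; it does not depend on u and i. *)
Definition cover_coroot (v w : affW) : 'rV[int]_k.+1 :=
  xget 0 [set mu | exists u i,
    [/\ (v^-1 * w = u * sgen i * u^-1)%g,
        forall m, 0 <= act_root u (alpha i) m 0
      & mu = act_coroot u (alphav i)]]%classic.

Local Notation freeA := {malg rat[{fmonom I}]}.

Definition fgen (i : I) : freeA := << fmu i >>.

(* The two-sided ideal generated by the nilCoxeter relations. *)
Inductive nil_ideal : freeA -> Prop :=
| nil_ideal0 : nil_ideal 0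
| nil_idealB x y : nil_ideal x -> nil_ideal y -> nil_ideal (x - y)
| nil_idealM a x b : nil_ideal x -> nil_ideal (a * x * b)
| nil_sqr i : nil_ideal (fgen i * fgen i)
| nil_comm i j : ~~ adj i j -> nil_ideal (fgen i * fgen j - fgen j * fgen i)
| nil_braid i j : (1 < k)%N -> i != j -> adj i j ->
    nil_ideal (fgen i * fgen j * fgen i - fgen j * fgen i * fgen j).

Definition nil_ideal_pred : {pred freeA} := fun x => `[< nil_ideal x >].

Lemma nil_ideal_zmod_closed : zmod_closed nil_ideal_pred.
Proof.
split=> [|x y /asboolP hx /asboolP hy]; apply/asboolP; first exact: nil_ideal0.
exact: nil_idealB.
Qed.

HB.instance Definition _ :=
  GRing.isZmodClosed.Build freeA nil_ideal_pred nil_ideal_zmod_closed.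

Definition fword (a : seq I) : freeA := << FMonom a >>.

Lemma fwordM a b : fword a * fword b = fword (a ++ b).
Proof. by rewrite malgM_def fgmulUU mulr1 /mmul /mul /= fmmulE. Qed.

Lemma fgenE i : fgen i = fword [:: i].
Proof. by rewrite /fgen fmuE. Qed.

Lemma fgen2 a i j b :
  fword a * (fgen i * fgen j) * fword b = fword (a ++ [:: i; j] ++ b).
Proof. by rewrite !fgenE (fwordM [:: i]) (fwordM a) fwordM -catA. Qed.

Lemma fgen3 a i j m b :
  fword a * (fgen i * fgen j * fgen m) * fword b
  = fword (a ++ [:: i; j; m] ++ b).
Proof.
by rewrite !fgenE (fwordM [:: i]) (fwordM [:: i; j]) (fwordM a) fwordM -catA.
Qed.

Lemma fword_prod a : \prod_(i <- a) fgen i = fword a.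
Proof.
elim: a => [|i a IH]; last by rewrite big_cons IH fgenE fwordM.
by rewrite big_nil /fword -fmoneE.
Qed.

(* Value at 1 of the action of a word on the free module over the group:
   nonreduced words act by 0. *)
Definition word_coord (m : {fmonom I}) : {malg rat[affW]} :=
  if size m == len (wprod m) then << wprod m >> else 0.

Definition free_coords : freeA -> {malg rat[affW]} := malg_lin word_coord.
HB.instance Definition _ := GRing.Linear.on free_coords.

Lemma free_coords0 : free_coords 0 = 0. Proof. exact: linear0. Qed.

Lemma free_coordsB : {morph free_coords : f g / f - g}.
Proof. by move=> f g; exact: linearB. Qed.

Lemma free_coordsZ c f : free_coords (c *: f) = c *: free_coords f.
Proof. exact: linearZ. Qed.

Lemma free_coords_sum (J : Type) (r : seq J) (F : J -> freeA) :
  free_coords (\sum_(m <- r) F m) = \sum_(m <- r) free_coords (F m).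
Proof. exact: linear_sum. Qed.

Lemma free_coords_word a :
  free_coords (fword a) = if size a == len (wprod a) then << wprod a >> else 0.
Proof. by rewrite /free_coords malg_linU scale1r. Qed.

Lemma wprod_cat a b : wprod (a ++ b) = (wprod a * wprod b)%g.
Proof. exact: big_cat. Qed.

Lemma free_coords_eq a b c d : size b = size c -> cox_eq b c ->
  free_coords (fword (a ++ b ++ d)) = free_coords (fword (a ++ c ++ d)).
Proof.
move=> sbc /wclsP; rewrite -!wprodE => bc.
by rewrite !free_coords_word !size_cat sbc !wprod_cat bc.
Qed.

Lemma malg_sum_words (f : freeA) : f = \sum_(m <- msupp f) f@_m *: fword m.
Proof.
rewrite {1}(monalgE f); apply: eq_bigr => m _; apply/malgP => m'.
by rewrite mcoeffZ !mcoeffU /fword fmK mulr_natr.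
Qed.

Lemma free_coords_mid p q :
  (forall m, free_coords (p * fword m * q) = 0) ->
  forall f, free_coords (p * f * q) = 0.
Proof.
move=> pq0 f; rewrite (malg_sum_words f).
rewrite (mulr_sumr _ _ _ p) (mulr_suml _ _ _ q) free_coords_sum big1 // => m _.
by rewrite -malg_scalerAr -scalerAl free_coordsZ pq0 scaler0.
Qed.

Lemma nil_ideal_coords f a b :
  nil_ideal f -> free_coords (fword a * f * fword b) = 0.
Proof.
have assoc1 (R : pzRingType) (u v w y z : R) :
  u * (v * w * y) * z = u * v * (w * (y * z)) by rewrite !mulrA.
have assoc2 (R : pzRingType) (u v w y z : R) :
  u * v * (w * (y * z)) = u * v * w * y * z by rewrite !mulrA.
have assoc3 (R : pzRingType) (u v w y : R) :
  u * v * w * y = u * v * (w * y) by rewrite !mulrA.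
have mulBB (u x y v : freeA) : u * (x - y) * v = u * x * v - u * y * v.
  by rewrite mulrBr mulrBl.
have fgenB (u x y v c d : freeA) : u * x * v = c -> u * y * v = d ->
    u * (x - y) * v = c - d by move=> <- <-; exact: mulBB.
move=> hf; elim: hf a b
  => {f} [|x y _ IHx _ IHy|g x h _ IH|i|i j ij|i j k1 ij aij] a b.
- by rewrite mulr0 mul0r free_coords0.
- rewrite mulBB free_coordsB.
  exact: etrans (congr2 (fun u v => u - v) (IHx a b) (IHy a b)) (subrr 0).
- rewrite assoc1; apply: free_coords_mid => m.
  rewrite assoc2 fwordM; apply: free_coords_mid => n.
  by rewrite assoc3 fwordM.
- rewrite fgen2 free_coords_word ifF //; apply/negbTE.
  have -> : wprod (a ++ [:: i; i] ++ b) = wprod (a ++ b).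
    rewrite !wprodE; apply/wclsP/cox_cat; first exact: cox_refl.
    exact: (cox_cat (cox_invol i) (cox_refl b)).
  apply/eqP => sz; have := len_le (a ++ b).
  by rewrite -sz !size_cat /=; lia.
- rewrite (fgenB _ _ _ _ _ _ (fgen2 a i j b) (fgen2 a j i b)) free_coordsB.
  apply/eqP; rewrite subr_eq0; apply/eqP/free_coords_eq => //.
  exact: cox_comm.
- rewrite (fgenB _ _ _ _ _ _ (fgen3 a i j i b) (fgen3 a j i j b)) free_coordsB.
  apply/eqP; rewrite subr_eq0; apply/eqP/free_coords_eq => //.
  exact: cox_braid.
Qed.

Lemma nil_ideal_coords0 f : nil_ideal f -> free_coords f = 0.
Proof.
move=> /(nil_ideal_coords [::] [::]).
by rewrite -fword_prod big_nil mul1r mulr1.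
Qed.

Definition nilA := {ideal_quot nil_ideal_pred}.

HB.instance Definition _ := GRing.Zmodule.on nilA.
HB.instance Definition _ : EqQuotient _ (Quotient.equiv nil_ideal_pred) nilA :=
  EqQuotient.on nilA.

Definition ncls (f : freeA) : nilA := \pi_nilA f.

Lemma nclsP f g : ncls f = ncls g <-> nil_ideal (f - g).
Proof.
rewrite /ncls; split=> [/eqP|h]; last apply/eqP.
  by rewrite -Quotient.idealrBE => /asboolP.
by rewrite -Quotient.idealrBE; apply/asboolP.
Qed.

Lemma ncls_repr x : ncls (repr x) = x. Proof. exact: reprK. Qed.

Lemma repr_ncls f : nil_ideal (repr (ncls f) - f).
Proof. by apply/nclsP; rewrite ncls_repr. Qed.

Lemma nclsD : {morph ncls : f g / f + g}.
Proof. by move=> f g; rewrite /ncls raddfD. Qed.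

Lemma nil_idealMl a x : nil_ideal x -> nil_ideal (a * x).
Proof. by move=> /(nil_idealM a 1); rewrite mulr1. Qed.

Lemma nil_idealMr x b : nil_ideal x -> nil_ideal (x * b).
Proof. by move=> /(nil_idealM 1 b); rewrite mul1r. Qed.

Lemma nil_idealD x y : nil_ideal x -> nil_ideal y -> nil_ideal (x + y).
Proof.
move=> hx hy; rewrite -[y]opprK -[- y]sub0r.
exact/nil_idealB/nil_idealB/hy/nil_ideal0.
Qed.

Definition nilA_one : nilA := ncls 1.
Definition nilA_mul : nilA -> nilA -> nilA :=
  locked (fun x y => ncls (repr x * repr y)).
Definition nilA_scale : rat -> nilA -> nilA :=
  locked (fun c x => ncls (c *: repr x)).

Lemma nilA_mulE f g : nilA_mul (ncls f) (ncls g) = ncls (f * g).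
Proof.
rewrite /nilA_mul -lock; apply/nclsP; set f' := repr _; set g' := repr _.
have -> : f' * g' - f * g = (f' - f) * g' + f * (g' - g).
  by rewrite mulrBl mulrBr addrA subrK.
by apply: nil_idealD; [apply: nil_idealMr | apply: nil_idealMl];
  apply: repr_ncls.
Qed.

Lemma nilA_scaleE c f : nilA_scale c (ncls f) = ncls (c *: f).
Proof.
rewrite /nilA_scale -lock; apply/nclsP; rewrite -scalerBr -[_ - f]mul1r scalerAl.
exact/nil_idealMl/repr_ncls.
Qed.

Lemma nilA_mulA : associative nilA_mul.
Proof.
move=> x y z; rewrite -(ncls_repr x) -(ncls_repr y) -(ncls_repr z).
by rewrite !nilA_mulE mulrA.
Qed.

Lemma nilA_mul1x : left_id nilA_one nilA_mul.
Proof. by move=> x; rewrite -(ncls_repr x) nilA_mulE mul1r. Qed.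

Lemma nilA_mulx1 : right_id nilA_one nilA_mul.
Proof. by move=> x; rewrite -(ncls_repr x) nilA_mulE mulr1. Qed.

Lemma nilA_mulDl : left_distributive nilA_mul +%R.
Proof.
move=> x y z; rewrite -(ncls_repr x) -(ncls_repr y) -(ncls_repr z).
by rewrite -nclsD !nilA_mulE mulrDl nclsD.
Qed.

Lemma nilA_mulDr : right_distributive nilA_mul +%R.
Proof.
move=> x y z; rewrite -(ncls_repr x) -(ncls_repr y) -(ncls_repr z).
by rewrite -nclsD !nilA_mulE mulrDr nclsD.
Qed.

Lemma nilA_one_neq0 : nilA_one != 0.
Proof.
have -> : (0 : nilA) = ncls 0 by rewrite /ncls raddf0.
apply/eqP => /nclsP; rewrite subr0 => /nil_ideal_coords0 /eqP.
have -> : (1 : freeA) = fword [::] by rewrite -fword_prod big_nil.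
have /eqP l0 : len (wprod [::]) == 0%N by rewrite -leqn0; exact: len_le.
by rewrite free_coords_word l0 monalgU_eq0 oner_eq0.
Qed.

HB.instance Definition _ := GRing.Zmodule_isNzRing.Build nilA
  nilA_mulA nilA_mul1x nilA_mulx1 nilA_mulDl nilA_mulDr nilA_one_neq0.

Lemma nclsM : {morph ncls : f g / f * g}.
Proof. by move=> f g; exact: esym (nilA_mulE f g). Qed.

Lemma ncls1 : ncls 1 = 1. Proof. by []. Qed.

Lemma nilA_scaleA a b x :
  nilA_scale a (nilA_scale b x) = nilA_scale (a * b) x.
Proof. by rewrite -(ncls_repr x) !nilA_scaleE scalerA. Qed.

Lemma nilA_scale1 : left_id 1 nilA_scale.
Proof. by move=> x; rewrite -(ncls_repr x) nilA_scaleE scale1r. Qed.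

Lemma nilA_scaleDr : right_distributive nilA_scale +%R.
Proof.
move=> a x y; rewrite -(ncls_repr x) -(ncls_repr y).
by rewrite -nclsD !nilA_scaleE scalerDr nclsD.
Qed.

Lemma nilA_scaleDl x : {morph nilA_scale^~ x : a b / a + b}.
Proof.
by move=> a b; rewrite -(ncls_repr x) !nilA_scaleE scalerDl nclsD.
Qed.

HB.instance Definition _ := GRing.Zmodule_isLmodule.Build rat nilA
  nilA_scaleA nilA_scale1 nilA_scaleDr nilA_scaleDl.

Lemma nclsZ a f : ncls (a *: f) = a *: ncls f.
Proof. exact: esym (nilA_scaleE a f). Qed.

Lemma nilA_scaleAl (a : rat) (x y : nilA) : a *: (x * y) = a *: x * y.
Proof.
rewrite -(ncls_repr x) -(ncls_repr y) -nclsZ -!nclsM -nclsZ.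
by rewrite scalerAl.
Qed.

HB.instance Definition _ := GRing.Lmodule_isLalgebra.Build rat nilA nilA_scaleAl.

Lemma nilA_scaleAr (a : rat) (x y : nilA) : a *: (x * y) = x * (a *: y).
Proof.
rewrite -(ncls_repr x) -(ncls_repr y) -nclsZ -!nclsM -nclsZ.
by rewrite malg_scalerAr.
Qed.

HB.instance Definition _ := GRing.Lalgebra_isAlgebra.Build rat nilA nilA_scaleAr.

Definition ngen (i : I) : nilA := ncls (fgen i).

Definition nil_elt (w : affW) : nilA := \prod_(i <- redword w) ngen i.

Lemma nword_prod a : \prod_(i <- a) ngen i = ncls (fword a).
Proof.
rewrite -fword_prod; elim: a => [|i a IH]; first by rewrite !big_nil.
by rewrite !big_cons IH nclsM.
Qed.

(* Coordinates on the basis [nil_elt w]: see [coords_elt].  The [nil_elt w] span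
   because, by Matsumoto's theorem, the product of generators along a word is
   [nil_elt w] if the word is a reduced word of w, and 0 if it is not reduced. *)
Definition coords (x : nilA) : {malg rat[affW]} := free_coords (repr x).

Lemma coords_ncls f : coords (ncls f) = free_coords f.
Proof.
apply/eqP; rewrite -subr_eq0 -linearB /=; apply/eqP.
exact/nil_ideal_coords0/repr_ncls.
Qed.

Lemma coords_is_linear : linear coords.
Proof.
move=> a x y; rewrite -(ncls_repr x) -(ncls_repr y) -nclsZ -nclsD.
by rewrite !coords_ncls linearP.
Qed.

HB.instance Definition _ := GRing.isLinear.Build rat nilA {malg rat[affW]}
  *:%R coords coords_is_linear.

Lemma coords_word w a :
  reduced_word w a -> coords (\prod_(i <- a) ngen i) = << w >>.
Proof.
move=> /andP[/eqP sa /eqP aw].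
by rewrite nword_prod coords_ncls free_coords_word sa aw eqxx.
Qed.

Lemma coords_elt w : coords (nil_elt w) = << w >>.
Proof. exact/coords_word/redwordP. Qed.

(* D_L, the linear map characterised by [down_elt]. *)
Definition down (L : 'cV[int]_k.+1) (x : nilA) : nilA :=
  malg_lin (fun w => \sum_(v \in [set v | cover v w]%classic)
                       (pair_weight (cover_coroot v w) L)%:~R *: nil_elt v)
           (coords x).

Lemma down_is_linear L : linear (down L).
Proof. by move=> a x y; rewrite /down !linearP. Qed.

HB.instance Definition _ L :=
  GRing.isLinear.Build rat nilA nilA *:%R (down L) (down_is_linear L).

Lemma down_elt L w :
  down L (nil_elt w) = \sum_(v \in [set v | cover v w]%classic)
                         (pair_weight (cover_coroot v w) L)%:~R *: nil_elt v.
Proof. by rewrite /down coords_elt malg_linU scale1r. Qed.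

(* w_S; for k >= 1 and S a proper subset the defining condition is satisfied by
   exactly one element. *)
Definition dec_elt (S : {set I}) : affW :=
  xget 1%g [set w | forall a, reduced_word w a ->
    perm_eq a (enum S) /\
    forall j, j \in S -> ordS j \in S -> (index (ordS j) a < index j a)%N]%classic.

Definition hgen (i : nat) : nilA :=
  \sum_(S : {set I} | #|S| == i) nil_elt (dec_elt S).

Definition fomin_stanley (x : nilA) : Prop :=
  forall B : {pred nilA}, GRing.subalg_closed B ->
    (forall i, (1 <= i <= k)%N -> hgen i \in B) -> x \in B.

End AffineTypeA.

(* Main.v *)
From HB Require Import structures.
From mathcomp Require Import finmap boolp classical_sets cardinality fsbigop.
From mathcomp Require Import monalg.
Require Import Defs.
From mathcomp Require Import all_boot all_order all_algebra.
From mathcomp Require Import zify ring.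

(* Put u_a for the product of generators along a word a.  Every nonreduced u_a
   vanishes, and D_L(u_a) is the sum over all factorizations a = p i q of
   <q^-1 alpha_i^vee, L> u_{pq}, whether or not a is reduced.  Hence
     D_L(x u_q) = D_{qL}(x) u_q + x D_L(u_q),
   and D_L satisfies the Leibniz rule on every x with D_{qL}(x) = D_L(x) for all
   q.  Such x form a subalgebra, which contains h_1, ..., h_k because
   D_L(h_m) = level(L) h_{m-1}: for L = Lambda_j, deleting i from w_S
   contributes 1 when the cyclic interval [j, i] lies in S and 0 otherwise, and
   each T with |T| = m - 1 < k arises exactly once, from S = T + {i} with i the
   first element outside T met when going up from j.  The same formula shows
   that D_L maps the generators of B, hence B, into B. *)

Set Implicit Arguments.
Unset Strict Implicit.
Unset Printing Implicit Defensive.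

Import Order.TTheory GRing.Theory Num.Theory.
Local Open Scope ring_scope.

Local Arguments len {k} w%_g.
Local Arguments act_root {k} w%_g lam.
Local Arguments act_coroot {k} w%_g mu.

(** * Strong exchange *)

Section CoxeterCombinatorics.


Variable k : nat.

Local Notation I := 'I_k.+1.
Local Notation W := (affW k).
Implicit Types (a b c p q : seq I) (i j : I) (w v x y t : W).

Lemma cox_wprod a b : cox_eq a b -> wprod a = wprod b.
Proof. by move=> ab; rewrite !wprodE; apply/wclsP. Qed.

Lemma wprod_cox a b : wprod a = wprod b -> cox_eq a b.
Proof. by rewrite !wprodE => /wclsP. Qed.

Lemma wprod_nil : wprod [::] = 1%g :> W.
Proof. by rewrite /wprod big_nil. Qed.

Lemma wprod_cons i a : wprod (i :: a) = (sgen i * wprod a)%g.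
Proof. by rewrite /wprod big_cons. Qed.

Lemma wprod1 i : wprod [:: i] = sgen i.
Proof. by rewrite wprod_cons wprod_nil mulg1. Qed.

Lemma sgen2 i : (sgen i * sgen i = 1)%g.
Proof.
by rewrite -wprod1 -wprod_cat -wprod_nil; apply/cox_wprod/cox_invol.
Qed.

Lemma sgenV i : ((sgen i)^-1 = sgen i)%g.
Proof. exact: mulg1_eq (sgen2 i). Qed.

Lemma sgenK i w : (sgen i * (sgen i * w) = w)%g.
Proof. by rewrite mulgA sgen2 mul1g. Qed.

Lemma mulg_sgenK i w : (w * sgen i * sgen i = w)%g.
Proof. by rewrite -mulgA sgen2 mulg1. Qed.

Lemma sgenJ i x : ((sgen i ^ x) * (sgen i ^ x) = 1)%g.
Proof. by rewrite -conjMg sgen2 conj1g. Qed.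

Lemma wprod_rev a : wprod (rev a) = (wprod a)^-1%g.
Proof.
elim: a => [|i a IH]; first by rewrite wprod_nil invg1.
by rewrite rev_cons -cats1 wprod_cat IH wprod1 wprod_cons invgM sgenV.
Qed.

Lemma wprod_surj w : {a | size a = len w & wprod a = w}.
Proof.
by have /andP[/eqP sa /eqP pa] := redwordP w; exists (redword w).
Qed.

Lemma len1 : len (1%g : W) = 0%N.
Proof. by apply/eqP; rewrite -leqn0 -wprod_nil; apply: len_le. Qed.

Lemma len_sgenM i w : (len (sgen i * w) <= (len w).+1)%N.
Proof.
case: (wprod_surj w) => a <- <-; rewrite -wprod_cons; exact: len_le.
Qed.

Lemma lenV w : len (w^-1)%g = len w.
Proof.
suff le x : (len (x^-1)%g <= len x)%N.
  by apply/eqP; rewrite eqn_leq le -{1}[w]invgK le.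
case: (wprod_surj x) => a <- <-; rewrite -wprod_rev -size_rev; exact: len_le.
Qed.

Lemma len_Msgen i w : (len (w * sgen i) <= (len w).+1)%N.
Proof. by rewrite -lenV invgM sgenV -(lenV w); apply: len_sgenM. Qed.

(** Each defining relation preserves the parity of the number of letters. *)
Lemma odd_len a : odd (len (wprod a)) = odd (size a).
Proof.
have odd_cox b c : cox_eq b c -> odd (size b) = odd (size c).
  elim=> {b c} // [b c d _ -> _ ->|b c d e _ + _ +] //.
  by rewrite !size_cat !oddD => -> ->.
case: (wprod_surj (wprod a)) => b <- ab.
exact/odd_cox/wprod_cox.
Qed.

Lemma odd_len_sgenM i w : odd (len (sgen i * w)) = ~~ odd (len w).
Proof.
by case: (wprod_surj w) => a _ <-; rewrite -wprod_cons !odd_len.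
Qed.

Lemma odd_len_Msgen i w : odd (len (w * sgen i)) = ~~ odd (len w).
Proof. by rewrite -lenV invgM sgenV odd_len_sgenM lenV. Qed.

(** By parity a generator changes the length by exactly one, so a non-ascent is a descent. *)
Lemma len_sgenM_desc i w : ~~ (len w < len (sgen i * w))%N ->
  len w = (len (sgen i * w)).+1.
Proof.
have := len_sgenM i (sgen i * w)%g; rewrite sgenK.
by have := odd_len_sgenM i w; lia.
Qed.

Lemma len_Msgen_desc i w : ~~ (len w < len (w * sgen i))%N ->
  len w = (len (w * sgen i)).+1.
Proof.
have := len_Msgen i (w * sgen i)%g; rewrite mulg_sgenK.
by have := odd_len_Msgen i w; lia.
Qed.

Definition is_red a : bool := size a == len (wprod a).

Lemma is_red_cons i a : is_red (i :: a) -> is_red a.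
Proof.
rewrite /is_red wprod_cons /= => /eqP sa; have := len_sgenM i (wprod a).
by rewrite -sa ltnS => le; rewrite eqn_leq le len_le.
Qed.

Lemma is_red_catr a b : is_red (a ++ b) -> is_red b.
Proof. by elim: a => // i a IH /is_red_cons. Qed.

(* The reflections t for which [wprod a * t] is obtained by deleting one letter
   of [a]. *)
Fixpoint reflist a : seq W :=
  if a is i :: q then (sgen i ^ wprod q)%g :: reflist q else [::].

Lemma reflist_cat a b :
  reflist (a ++ b) = [seq (t ^ wprod b)%g | t <- reflist a] ++ reflist b.
Proof. by elim: a => //= i a ->; rewrite wprod_cat conjgM. Qed.

Lemma mem_reflist a t : t \in reflist a ->
  exists p i q, [/\ a = p ++ i :: q, t = (sgen i ^ wprod q)%g
                  & (wprod a * t = wprod (p ++ q))%g].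
Proof.
elim: a => //= i a IH; rewrite inE => /orP[/eqP ->|/IH].
  exists [::], i, a; split=> //=.
  by rewrite wprod_cons -mulgA -conjgC sgenK.
case=> p [j [q [-> -> e]]]; exists (i :: p), j, q; split=> //=.
by rewrite wprod_cons -mulgA e wprod_cons.
Qed.

Lemma count_conj (s : seq W) t x :
  count_mem t [seq (u ^ x)%g | u <- s] = count_mem (t ^ x^-1)%g s.
Proof.
rewrite count_map; apply: eq_count => u /=.
by apply/eqP/eqP => [<-|->]; rewrite ?conjgK ?conjgKV.
Qed.

(** [reflist a] depends on the word, but this parity turns out to depend only on the group element:
    it is the reflection cocycle modulo 2. *)
Definition par t a : bool := odd (count_mem t (reflist a)).

Lemma par_cat t a b : par t (a ++ b) = par (t ^ (wprod b)^-1)%g a (+) par t b.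
Proof. by rewrite /par reflist_cat count_cat oddD count_conj. Qed.

(** Cancelling [i i] removes the same reflection twice, a commutation swaps two entries of
    [reflist], and a braid move reverses three. *)
Lemma par_cox a b : cox_eq a b -> forall t, par t a = par t b.
Proof.
elim=> {a b} [a|a b _ IH|a b c _ ab _ bc|a b c d ab IH1 cd IH2|i|i j ij
             |i j k1 ij aij] t //.
- by rewrite ab.
- by rewrite !par_cat IH1 IH2 (cox_wprod cd).
- rewrite /par /= wprod1 wprod_nil conjg1 conjgE sgen2 mulg1 sgenV.
  by rewrite addn0 addnn odd_double.
- have e : (sgen i * sgen j = sgen j * sgen i)%g.
    by have := cox_wprod (cox_comm ij); rewrite !wprod_cons wprod_nil !mulg1.
  rewrite /par /= !wprod1 wprod_nil !conjg1 !conjgE e -e !sgenV !sgenK.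
  by rewrite e sgenK addnCA.
- have e : (sgen i * (sgen j * sgen i) = sgen j * (sgen i * sgen j))%g.
    have := cox_wprod (cox_braid k1 ij aij).
    by rewrite !wprod_cons wprod_nil !mulg1.
  rewrite /par /= !wprod_cons !wprod_nil !mulg1 !conjg1.
  have c x y z : (x ^ (y * z) = z^-1 * (y^-1 * (x * (y * z))))%g.
    by rewrite conjgE invgM !mulgA.
  rewrite !c !conjgE !sgenV e !sgenK -e !sgenK.
  by congr odd; lia.
Qed.

Lemma par_wprod a b t : wprod a = wprod b -> par t a = par t b.
Proof. by move/wprod_cox/par_cox. Qed.

(** Without its middle letter the palindrome represents 1 and has even parity. The middle letter
    adds one occurrence and leaves the contributions of both halves unchanged. *)
Lemma par_self i b : par (sgen i ^ wprod b)%g (rev b ++ i :: b).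
Proof.
have e1 : par (sgen i ^ wprod b)%g (rev b ++ b) = false.
  rewrite (@par_wprod _ [::]) // wprod_cat wprod_rev mulVg wprod_nil //.
have e2 : (sgen i ^ sgen i = sgen i)%g by rewrite conjgE sgenV sgenK.
move: e1; rewrite -cat1s catA !par_cat conjgK wprod1 sgenV e2.
have -> : par (sgen i) [:: i] by rewrite /par /= wprod_nil conjg1 eqxx.
by case: (par _ (rev b)); case: (par _ b).
Qed.

(** If the reflection had even parity in [a], the cocycle rule would give it odd parity in a reduced
    word [c] of the shortened element. Deleting a letter of [c] would then express [wprod a] with
    fewer letters than [c], against the drop in length. *)
Lemma strong_exchange a i x :
  (len (wprod a * (sgen i ^ x)) < len (wprod a))%N ->
  (sgen i ^ x)%g \in reflist a.
Proof.
case: (wprod_surj x) => b _ <- {x}; set t := (sgen i ^ wprod b)%g => lt.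
suff : par t a by rewrite /par; apply: contraLR => /count_memPn->.
case: (wprod_surj (wprod a * t)%g) => c sc pc.
have wt : wprod (rev b ++ i :: b) = t.
  by rewrite wprod_cat wprod_rev wprod_cons /t conjgE.
have : par t c = par t (a ++ (rev b ++ i :: b)).
  by apply: par_wprod; rewrite pc wprod_cat wt.
rewrite par_cat par_self wt.
have -> : (t ^ t^-1 = t)%g by rewrite conjgE mulgV mulg1 invgK.
case: (par t a) => // /esym pt; exfalso.
have : t \in reflist c.
  by move: pt => /esym; rewrite /par; apply: contraTT => /count_memPn->.
case/mem_reflist => p [j [q [ec _ e]]].
have := len_le (p ++ q); rewrite -e pc -mulgA sgenJ mulg1.
have := congr1 size ec; rewrite !size_cat sc /=; lia.
Qed.

Lemma exchange_l a i : (len (sgen i * wprod a) < len (wprod a))%N ->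
  exists p j q, a = p ++ j :: q /\ (sgen i * wprod a = wprod (p ++ q))%g.
Proof.
rewrite conjgC => /strong_exchange/mem_reflist[p [j [q [-> _ e]]]].
by exists p, j, q.
Qed.

(** If the reflection of the first letter recurred, that letter and a later one could both be
    deleted without changing the product. *)
Lemma reflist_uniq a : is_red a -> uniq (reflist a).
Proof.
elim: a => //= i a IH ra; rewrite IH ?(is_red_cons ra) // andbT.
apply/negP => /mem_reflist[p [j [q [ea _ e]]]].
move: ra; rewrite /is_red wprod_cons conjgC e => /eqP /=.
by have := len_le (p ++ q); rewrite ea !size_cat /=; lia.
Qed.

End CoxeterCombinatorics.

(** * Roots and lengths *)

Section Roots.

Variable k : nat.

Local Notation I := 'I_k.+1.
Local Notation W := (affW k).
Implicit Types (a b c p q : seq I) (i j : I) (u v w x y t : W).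
Implicit Types (lam mu : 'cV[int]_k.+1).

Lemma refl_root_is_linear i : linear (@refl_root k i).
Proof.
move=> c lam mu; rewrite /refl_root /pair_root mulmxDr -scalemxAr !mxE.
by rewrite scalerDl -scalerA scalerBr opprD addrACA.
Qed.

HB.instance Definition _ i := GRing.isLinear.Build int
  'cV[int]_k.+1 'cV[int]_k.+1 *:%R (@refl_root k i) (refl_root_is_linear i).

Lemma act_root_is_linear w : linear (act_root w).
Proof.
move=> c lam mu; rewrite /act_root; elim: (repr w) => //= i a ->.
exact: linearP.
Qed.

HB.instance Definition _ w := GRing.isLinear.Build int
  'cV[int]_k.+1 'cV[int]_k.+1 *:%R (act_root w) (act_root_is_linear w).

Lemma act_root1 lam : act_root 1 lam = lam.
Proof. exact: (refl_root_cox _ (repr_cox [::])). Qed.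

Lemma act_rootK w : cancel (act_root w) (act_root w^-1).
Proof. by move=> lam; rewrite -act_rootM mulVg act_root1. Qed.

Lemma act_rootVK w : cancel (act_root w^-1) (act_root w).
Proof. by move=> lam; rewrite -act_rootM mulgV act_root1. Qed.

Lemma refl_root_alpha i j :
  refl_root i (alpha j) = alpha j - cartan i j *: alpha i.
Proof. by rewrite /refl_root pair_rootE. Qed.

Lemma refl_root_self i : refl_root i (alpha i) = - alpha i.
Proof.
rewrite refl_root_alpha /cartan eqxx scaler_nat mulr2n opprD addrA subrr.
exact: sub0r.
Qed.

Lemma alphaE i m : alpha i m 0 = (m == i)%:R.
Proof. by rewrite mxE eqxx andbT. Qed.

(** Generators are told apart by the coordinate at [i] of the image of [alpha i]: it is -1 under
    [sgen i] and 1 under any other generator. *)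
Lemma sgen_inj : injective (@sgen k).
Proof.
move=> i j ij; apply/eqP/negPn/negP => nij.
have := congr1 (fun lam : 'cV[int]_k.+1 => lam i 0)
  (congr1 (act_root ^~ (alpha i)) ij).
rewrite !act_root_sgen refl_root_self refl_root_alpha !mxE !eqxx.
by rewrite (negPf nij) mulr0.
Qed.

Lemma pair_root_tr (mu : 'rV[int]_k.+1) lam :
  pair_root mu lam = pair_root lam^T mu^T.
Proof.
rewrite /pair_root -[in LHS](trmxK (mu *m _ *m _)) mxE !trmx_mul mulmxA.
congr ((_ *m _ *m _) 0 0); apply/matrixP => i j; rewrite !mxE; exact: cartanC.
Qed.

(** The Cartan matrix is symmetric, so transposition reduces statements on coroots to statements on
    roots. *)
Lemma act_coroot_tr w (mu : 'rV[int]_k.+1) :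
  act_coroot w mu = (act_root w mu^T)^T.
Proof.
rewrite /act_coroot /act_root; elim: (repr w) => [|i a IH] /=.
  by rewrite trmxK.
rewrite IH; move: (foldr _ _ a) => lam; rewrite /refl_coroot /refl_root.
rewrite [RHS]linearB [in RHS]linearZ /=.
by rewrite pair_root_tr trmxK /alphav /alpha !trmx_delta.
Qed.

Lemma alphav_tr i : (alphav i)^T = alpha i.
Proof. exact: trmx_delta. Qed.

Definition nonneg lam := forall m, 0 <= lam m 0.

Lemma nonnegD lam mu : nonneg lam -> nonneg mu -> nonneg (lam + mu).
Proof. by move=> h1 h2 m; rewrite mxE addr_ge0. Qed.

Lemma nonneg_alpha i : nonneg (alpha i).
Proof. by move=> m; rewrite alphaE ler0n. Qed.

Lemma nonneg_anti lam : nonneg lam -> nonneg (- lam) -> lam = 0.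
Proof.
move=> h1 h2; apply/matrixP => m n; rewrite ord1 mxE.
by apply/eqP; rewrite eq_le h1 andbT -oppr_ge0; have := h2 m; rewrite mxE.
Qed.

Lemma act_root_alpha_neq0 w i : act_root w (alpha i) != 0.
Proof.
apply/eqP => /(congr1 (act_root w^-1)); rewrite act_rootK linear0.
move=> /(congr1 (fun lam : 'cV[int]_k.+1 => lam i 0)) /eqP.
by rewrite alphaE eqxx mxE.
Qed.

Lemma act_root_refl u i lam : act_root (u * sgen i * u^-1) lam
  = lam - pair_root (alphav i) (act_root u^-1 lam) *: act_root u (alpha i).
Proof.
by rewrite !act_rootM act_root_sgen /refl_root linearB linearZ /= act_rootVK.
Qed.

(** This makes [cover_coroot] independent of choices. Two roots with the same reflection are integer
    multiples of each other, hence equal up to sign, and positivity fixes the sign. *)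
Lemma refl_posroot_uniq u v i j :
  (u * sgen i * u^-1 = v * sgen j * v^-1)%g ->
  nonneg (act_root u (alpha i)) -> nonneg (act_root v (alpha j)) ->
  act_root u (alpha i) = act_root v (alpha j).
Proof.
set be := act_root u (alpha i); set ga := act_root v (alpha j) => e be0 ga0.
(* [b *+ 2 = n *: g] with [n] even, as [g] belongs to a basis of the lattice. *)
have half x y i1 j1 : (x * sgen i1 * x^-1 = y * sgen j1 * y^-1)%g ->
    exists c : int, act_root x (alpha i1) = c *: act_root y (alpha j1).
  move=> exy; set b := act_root x _; set g := act_root y _.
  have : act_root (x * sgen i1 * x^-1) b = - b.
    rewrite act_root_refl act_rootK pair_rootE /cartan eqxx -/b.
    by rewrite scaler_nat mulr2n opprD addrA subrr sub0r.
  rewrite exy act_root_refl -/g; set n := pair_root _ _ => hb.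
  have b2 : b *+ 2 = n *: g.
    apply/eqP; rewrite mulr2n -subr_eq0 -addrA; apply/eqP.
    by rewrite hb subrr.
  exists (act_root y^-1 b j1 0).
  have : (act_root y^-1 b) *+ 2 = n *: alpha j1.
    by rewrite -linearMn b2 linearZ /= act_rootK.
  move=> /(congr1 (fun lam : 'cV[int]_k.+1 => lam j1 0)).
  rewrite mulmxnE mxE alphaE eqxx mulr1 => hc.
  apply/matrixP => m o.
  move: b2 => /(congr1 (fun lam : 'cV[int]_k.+1 => lam m o)).
  rewrite mulmxnE -hc [RHS]mxE mulrnAl => /eqP.
  by rewrite eqr_pMn2r // => /eqP ->; rewrite mxE.
have [c bc] := half _ _ _ _ e; have [d gd] := half _ _ _ _ (esym e).
rewrite -/be -/ga in bc gd.
have cd : c * d = 1.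
  have : (c * d) *: alpha i = alpha i.
    by rewrite -(act_rootK u (alpha i)) -linearZ /= -/be -scalerA -gd -bc.
  move=> /(congr1 (fun lam : 'cV[int]_k.+1 => lam i 0)).
  by rewrite mxE alphaE eqxx mulr1.
have [c1|cm1] : c = 1 \/ c = -1.
  have : (absz c * absz d == 1)%N by rewrite -abszM cd.
  by rewrite muln_eq1 => /andP[/eqP c1 _]; lia.
  by rewrite bc c1 scale1r.
case/eqP: (act_root_alpha_neq0 u i); apply: nonneg_anti => //.
by rewrite -/be bc cm1 scaleN1r opprK.
Qed.

Hypothesis hk : (0 < k)%N.

(** * The affine Cartan matrix and the null root *)

Lemma ordS_neq i : (i == ordS i) = false.
Proof.
apply/negP => /eqP /(congr1 val) /= e; have := ltn_ord i; rewrite ltnS => le.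
have [lt|ge] := ltnP i k.
  by move: e; rewrite modn_small ?ltnS //; lia.
have ei : i = k :> nat by lia.
by move: e; rewrite ei modnn; lia.
Qed.

(** A uniform formula: for [k = 1] an off-diagonal entry collects both indicators and equals -2. *)
Lemma cartanE i j :
  cartan i j = (i == j)%:R * 2 - (i == ordS j)%:R - (j == ordS i)%:R.
Proof.
rewrite /cartan; case: eqP => [->|_]; last by rewrite mul0r sub0r opprD.
by rewrite !ordS_neq mul1r !subr0.
Qed.

(** The affine Cartan matrix is minus the second difference along the cycle; for [k = 1] the two
    neighbours coincide and count twice. *)
Lemma pair_root_alphav i lam : pair_root (alphav i) lam =
  lam i 0 * 2 - lam (ord_pred i) 0 - lam (ordS i) 0.
Proof.
rewrite /pair_root -rowE mxE.
under eq_bigr => j _ do rewrite !mxE cartanE !mulrBl.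
have pick (f : I -> bool) (n : int) j0 :
    (forall j, f j = (j == j0)) -> \sum_j (f j)%:R * n * lam j 0 = n * lam j0 0.
  move=> fE; rewrite (bigD1 j0) //= fE eqxx mul1r big1 ?addr0 // => j.
  by rewrite fE => /negPf->; rewrite !mul0r.
have pick1 (f : I -> bool) j0 :
    (forall j, f j = (j == j0)) -> \sum_j (f j)%:R * lam j 0 = lam j0 0.
  by move=> /(pick _ 1) e; rewrite -[RHS]mul1r -e; apply: eq_bigr => j _;
    rewrite mulr1.
rewrite !sumrB (pick _ _ i) => [|j]; last exact: eq_sym.
rewrite (pick1 _ (ord_pred i)) => [|j]; last first.
  by apply/eqP/eqP => ->; rewrite ?ordSK ?ord_predK.
by rewrite (pick1 _ (ordS i)) // mulrC.
Qed.

(** Constant vectors are the multiples of the null root, the sum of all simple roots. *)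
Lemma refl_root_const i (n : int) : refl_root i (const_mx n) = const_mx n.
Proof.
rewrite /refl_root pair_root_alphav !mxE (_ : _ - _ - _ = 0); last by ring.
by rewrite scale0r subr0.
Qed.

(** The sum of the simple coroots pairs to zero with every root; this makes the level of a weight
    invariant under reflections. *)
Lemma cartan_sum i : \sum_j cartan j i = 0.
Proof.
have := pair_root_alphav i (const_mx 1); rewrite !mxE (_ : _ - _ - _ = 0) //.
rewrite /pair_root -rowE mxE => e; rewrite -[RHS]e; apply: eq_bigr => j _.
by rewrite !mxE mulr1 cartanC.
Qed.

Lemma act_root_const w (n : int) : act_root w (const_mx n) = const_mx n.
Proof.
by rewrite /act_root; elim: (repr w) => //= i a ->; apply: refl_root_const.
Qed.

(** With only two indices there is no braid relation: the infinite dihedral group is treated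
    separately, through the null root. *)
Lemma I2_eq i j m : (k <= 1)%N -> i != j -> (m == i) = (m != j).
Proof.
have := ltn_ord i; have := ltn_ord j; have := ltn_ord m.
by rewrite -!(inj_eq val_inj) /=; lia.
Qed.

Lemma alpha_sum2 i j : (k <= 1)%N -> i != j -> alpha i + alpha j = const_mx 1.
Proof.
move=> k1 ij; apply/matrixP => m n; rewrite ord1 !mxE !eqxx !andbT.
by rewrite (I2_eq m k1 ij); case: (m == j).
Qed.

Lemma I2_ordS i j : (k <= 1)%N -> i != j -> j = ordS i.
Proof.
move=> k1; rewrite eq_sym => ij; apply/eqP.
by rewrite eq_sym (I2_eq (ordS i) k1 ij) eq_sym ordS_neq.
Qed.

(** The Cartan entry is -2, so the image is [alpha i + 2 alpha j], rewritten with the null root. *)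
Lemma refl_root_alpha2 i j : (k <= 1)%N -> i != j ->
  refl_root j (alpha i) = const_mx 1 + alpha j.
Proof.
move=> k1 ij; rewrite -(alpha_sum2 k1 ij) refl_root_alpha cartanE.
rewrite eq_sym (negPf ij) mul0r sub0r -(I2_ordS k1 ij) eqxx.
rewrite -(@I2_ordS j i) ?eqxx 1?eq_sym // -opprD scaleNr opprK.
by rewrite scalerDl !scale1r addrA.
Qed.

Lemma sgen_comm i j : ~~ adj i j -> (sgen i * sgen j = sgen j * sgen i)%g.
Proof.
move=> ij; have := cox_wprod (cox_comm ij).
by rewrite !wprod_cons wprod_nil !mulg1.
Qed.

Lemma sgen_braid i j : (1 < k)%N -> i != j -> adj i j ->
  (sgen i * sgen j * sgen i = sgen j * sgen i * sgen j)%g.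
Proof.
move=> k1 ij aij; have := cox_wprod (cox_braid k1 ij aij).
by rewrite !wprod_cons wprod_nil !mulg1 !mulgA.
Qed.

Lemma last_desc w : w != 1%g -> exists i, w = (w * sgen i * sgen i)%g /\
  len w = (len (w * sgen i)).+1.
Proof.
have /andP[/eqP s /eqP wa] := redwordP w; move: s wa.
case: (lastP (redword w)) => [|a i] s wa.
  by rewrite -wa wprod_nil eqxx.
move=> _; exists i; split; first by rewrite mulg_sgenK.
apply: len_Msgen_desc; rewrite -leqNgt -s size_rcons.
apply: leqW; rewrite -wa -cats1 wprod_cat wprod1 mulg_sgenK; exact: len_le.
Qed.

(** Induction on the length: write [w = v s_j] with [v] shorter, where [j] differs from [i] since
    [i] is an ascent, and split on how [i] and [j] are linked. *)
Lemma posroot w i : (len w < len (w * sgen i))%N ->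
  nonneg (act_root w (alpha i)).
Proof.
have [n] := ubnP (len w); elim: n w i => // n IH w i wn lwi.
have [->|w1] := eqVneq w 1%g; first by rewrite act_root1; apply: nonneg_alpha.
have [j [e lw]] := last_desc w1; move: (w * sgen j)%g lw e => v lw e.
have ij : i != j.
  by apply/eqP => eij; move: lwi; rewrite lw e eij mulg_sgenK ltnNge leqnSn.
have vn : (len v < n)%N by lia.
have vj : nonneg (act_root v (alpha j)) by apply: IH => //; rewrite -e lw.
rewrite e act_rootM act_root_sgen.
(* Dihedral case: [w] sends [alpha i] to the null root plus [v (alpha j)]. *)
have [k1|k1] := leqP k 1.
  rewrite refl_root_alpha2 // linearD /= act_root_const.
  by apply: nonnegD => // m; rewrite mxE.
(* Commuting case: [w (alpha i) = v (alpha i)], and a descent of [v] at [i] would be one of [w]. *)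
have [aij|aij] := boolP (adj i j); last first.
  rewrite refl_root_alpha cartanC cartan_nonadj // scale0r subr0.
  apply: IH => //; apply: contraTT lwi => /len_Msgen_desc lv.
  have -> : (w * sgen i = v * sgen i * sgen j)%g.
    by rewrite e -!mulgA (sgen_comm aij).
  by have := len_Msgen j (v * sgen i)%g; lia.
have rij (x y : I) : x != y -> adj x y ->
    refl_root x (alpha y) = alpha x + alpha y.
  by move=> xy axy; rewrite refl_root_alpha cartan_adj // scaleN1r opprK addrC.
have aji : adj j i by rewrite /adj orbC.
have ji : j != i by rewrite eq_sym.
rewrite rij //.
(* Here [w (alpha i) = v (alpha j) + v (alpha i)]. If [v = v' s_i] with [v'] shorter, this is
   [v' (alpha j)], and by the braid relation a descent of [v'] at [j] would force one of [w] at
   [i]. *)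
have [lvi|/len_Msgen_desc] := boolP (len v < len (v * sgen i))%N.
  by rewrite linearD /=; apply: nonnegD => //; apply: IH.
move: (v * sgen i)%g (esym (mulg_sgenK i v)) => v' ev lv'.
have e2 : refl_root i (alpha j + alpha i) = alpha j.
  by rewrite (linearD (refl_root i)) /= refl_root_self rij // addrAC subrr add0r.
rewrite ev act_rootM act_root_sgen e2.
apply: IH; first by lia.
apply: contraTT lwi => /len_Msgen_desc lv2.
have -> : (w * sgen i = v' * sgen j * sgen i * sgen j)%g.
  rewrite e ev -!mulgA; congr (_ * _)%g; rewrite !mulgA.
  exact: sgen_braid.
have := len_Msgen j (v' * sgen j * sgen i)%g.
by have := len_Msgen i (v' * sgen j)%g; lia.
Qed.

Lemma is_red_posroot i a : is_red (i :: a) ->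
  nonneg (act_root (wprod a)^-1 (alpha i)).
Proof.
move=> ra; apply: posroot; rewrite -(sgenV i) -invgM !lenV -wprod_cons.
by move: (ra) (is_red_cons ra) => /eqP <- /eqP <-.
Qed.

Lemma desc_negroot i w : (len (sgen i * w) < len w)%N ->
  nonneg (- act_root w^-1 (alpha i)).
Proof.
move=> lt; have e : (w^-1 = (sgen i * w)^-1 * sgen i)%g.
  by rewrite invgM sgenV mulg_sgenK.
rewrite e act_rootM act_root_sgen refl_root_self linearN opprK.
by apply: posroot; rewrite -e !lenV.
Qed.

(** Reducedness makes the root read off from the suffix [q] positive; uniqueness of the positive
    root of a reflection identifies its coroot with the value chosen by [xget]. *)
Lemma cover_corootE v w q i :
  (v^-1 * w = sgen i ^ wprod q)%g -> is_red (i :: q) ->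
  cover_coroot v w = act_coroot (wprod q)^-1 (alphav i).
Proof.
move=> e /is_red_posroot pos; rewrite /cover_coroot.
have e' : (v^-1 * w = (wprod q)^-1 * sgen i * (wprod q)^-1^-1)%g.
  by rewrite e conjgE invgK mulgA.
case: xgetP => [_ -> [u [j [e1 pos1 ->]]]|
  /(_ (act_coroot (wprod q)^-1 (alphav i)))].
  rewrite !act_coroot_tr !alphav_tr; congr trmx.
  by apply: refl_posroot_uniq => //; rewrite -e1.
by case; exists (wprod q)^-1%g, i.
Qed.

End Roots.

(** * Reduced words *)

Section Matsumoto.

Variable k : nat.

Local Notation I := 'I_k.+1.
Local Notation W := (affW k).
Implicit Types (a b c p q : seq I) (i j : I) (u v w x y t : W).

(** Only the length-preserving relations, applied inside a word: the equivalence of Matsumoto's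
    theorem. *)
Inductive braid : seq I -> seq I -> Prop :=
| braid_refl a : braid a a
| braid_trans a b c : braid a b -> braid b c -> braid a c
| braid_swap p i j q : ~~ adj i j ->
    braid (p ++ [:: i; j] ++ q) (p ++ [:: j; i] ++ q)
| braid_move p i j q : (1 < k)%N -> i != j -> adj i j ->
    braid (p ++ [:: i; j; i] ++ q) (p ++ [:: j; i; j] ++ q).

Lemma adjC i j : adj i j = adj j i.
Proof. exact: orbC. Qed.

Lemma braid_sym a b : braid a b -> braid b a.
Proof.
elim=> {a b} [a|a b c _ ab _ bc|p i j q ij|p i j q k1 ij aij].
- exact: braid_refl.
- exact: braid_trans bc ab.
- by apply: braid_swap; rewrite adjC.
- by apply: braid_move; rewrite 1?eq_sym // adjC.
Qed.

Lemma braid_cons i a b : braid a b -> braid (i :: a) (i :: b).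
Proof.
elim=> {a b} [a|a b c _ ab _ bc|p j l q jl|p j l q k1 jl ajl].
- exact: braid_refl.
- exact: braid_trans ab bc.
- exact: (braid_swap (i :: p)).
- exact: (braid_move (i :: p)).
Qed.

Hypothesis hk : (0 < k)%N.

(** Induction on the length. If the first letters [i] and [j] differ, both are left descents;
    exchange produces words starting with the two sides of the relation between [i] and [j], and the
    induction links them to [a] and [b]. *)
Lemma matsumoto a b : is_red a -> size b = size a -> wprod a = wprod b ->
  braid a b.
Proof.
have [n] := ubnP (size a); elim: n a b => // n IH [|i a] [|j b] //.
  by move=> *; apply: braid_refl.
rewrite ltnS => sa ra [sb] ab.
have ra' := is_red_cons ra.
have rb : is_red (j :: b) by rewrite /is_red -ab /= sb; exact: ra.
have rb' := is_red_cons rb.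
set w := wprod (i :: a) in ab.
have wi : (sgen i * w = wprod a)%g by rewrite /w wprod_cons sgenK.
have wj : (sgen j * w = wprod b)%g by rewrite ab wprod_cons sgenK.
have [eij|ij] := eqVneq i j.
  rewrite -eij; apply/braid_cons/IH => //.
  by rewrite -wi -wj eij.
have lw : len w = (size a).+1 by have /eqP := ra.
have li : (len (sgen i * w) < len w)%N.
  by rewrite wi lw ltnS; have /eqP <- := ra'.
have lj : (len (sgen j * w) < len w)%N.
  by rewrite wj lw ltnS -sb; have /eqP <- := rb'.
have ji : j != i by rewrite eq_sym.
have [p [l [q [ea e]]]] := exchange_l lj.
have sij : sgen i != sgen j by apply: contra_neq ij => /sgen_inj.
(* Deleting the leading [i] would give [s_j w = s_i w], so the deleted letter lies in [a]. *)
case: p ea e => [|i' p] [ei ea] e.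
  case/eqP: sij; apply: (mulIg (wprod a)).
  by rewrite -wprod_cons -/w ea -e sgenK.
move: e; rewrite -{}ei => e {i'}.
pose a2 := p ++ q.
have sa2 : size a = (size a2).+1 by rewrite ea !size_cat /= addnS.
have we : w = (sgen j * (sgen i * wprod a2))%g by rewrite -wprod_cons -e sgenK.
have wae : wprod a = (sgen i * (sgen j * (sgen i * wprod a2)))%g.
  by rewrite -wi we.
have wbe : wprod b = (sgen i * wprod a2)%g by rewrite -wj we sgenK.
have [aij|aij] := boolP (adj i j); last first.
  have h1 : braid a (j :: a2).
    apply: IH => //.
    rewrite wae (mulgA (sgen i)) (sgen_comm aij) -mulgA sgenK.
    by rewrite wprod_cons.
  have h2 : braid b (i :: a2).
    by apply: IH; rewrite ?sb //= ?sa2 // wprod_cons.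
  apply: braid_trans (braid_cons i h1) _.
  apply: braid_trans (braid_sym (braid_cons j h2)).
  exact: (braid_swap [::] a2 aij).
(* In the dihedral case [w^-1] would make [alpha i] and [alpha j] both negative, whereas it fixes
   their sum, the null root. *)
have [k1|k1] := leqP k 1.
  have := nonnegD (desc_negroot hk li) (desc_negroot hk lj).
  rewrite -opprD -linearD /= alpha_sum2 // act_root_const // => /(_ ord0).
  by rewrite !mxE.
have wji : wprod (j :: i :: a2) = w by rewrite !wprod_cons we.
have li' : (len (sgen i * wprod (j :: i :: a2)) < len (wprod (j :: i :: a2)))%N.
  by rewrite wji.
(* In this second exchange the deleted letter lies in [a2]: deleting [j] would make [w] too short,
   and deleting [i] would give [s_i s_j s_i = s_j], refuted on [alpha j]. *)
have [p2 [l2 [q2 [ea2 e2]]]] := exchange_l li'.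
case: p2 ea2 e2 => [|j' p2] [ej ea2] e2.
  have : w = wprod a2.
    by rewrite -(sgenK i w) -wji e2 -ea2 wprod_cons sgenK.
  move=> wa2; have := len_le a2; rewrite -wa2 lw; lia.
case: p2 ea2 e2 => [|i' p2] [ei ea2] e2.
  have : (sgen i * (sgen j * (sgen i * wprod a2)) = sgen j * wprod a2)%g.
    by move: e2; rewrite -ej -ea2 !wprod_cons.
  move=> /(congr1 (fun x => sgen i * x)%g) /=; rewrite sgenK !mulgA => /mulIg eji.
  have := congr1 (fun lam : 'cV[int]_k.+1 => lam i 0)
    (congr1 (fun x => act_root x (alpha j)) eji).
  rewrite !act_rootM !act_root_sgen refl_root_self !refl_root_alpha.
  rewrite (linearN (refl_root i)) (linearB (refl_root j)).
  rewrite (linearZ_LR (refl_root j)) /= refl_root_self !refl_root_alpha.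
  rewrite cartan_adj // (cartan_adj k1 ji) 1?adjC // !mxE !eqxx (negPf ij) /=.
  by rewrite !mulr0.
move: e2; rewrite -{}ej -{}ei /= => e2 {j' i'}.
pose a3 := p2 ++ q2.
have sa3 : size a2 = (size a3).+1 by rewrite ea2 !size_cat /= addnS.
have we3 : w = (sgen i * (sgen j * (sgen i * wprod a3)))%g.
  by rewrite -(wprod_cons i a3) -(wprod_cons j) -e2 wji sgenK.
have h1 : braid a (j :: i :: a3).
  by apply: IH => //=; rewrite ?sa2 ?sa3 // -wi we3 sgenK !wprod_cons.
have h2 : braid b (i :: j :: a3).
  apply: IH => //=; [by rewrite sb | try lia..]; rewrite -wj we3.
  have := sgen_braid k1 ij aij => /(congr1 (fun x => sgen j * (x * wprod a3))%g).
  by rewrite /= -!mulgA !sgenK !wprod_cons => ->.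
apply: braid_trans (braid_cons i h1) _.
apply: braid_trans (braid_sym (braid_cons j h2)).
exact: (braid_move [::] a3 k1 ij aij).
Qed.

(** The shortest nonreduced suffix has a reduced tail with its first letter as a left descent;
    Matsumoto's theorem brings that letter to the front of the tail. *)
Lemma nonred_braid a : ~~ is_red a ->
  exists p i q, braid a (p ++ [:: i; i] ++ q).
Proof.
elim: a => [|i a IH]; first by rewrite /is_red wprod_nil len1.
have [ra|/IH[p [j [q h]]] _] := boolP (is_red a); last first.
  by exists (i :: p), j, q; apply: braid_cons.
move=> nr; have {nr} : ~~ (len (wprod a) < len (sgen i * wprod a))%N.
  apply: contra nr; rewrite /is_red wprod_cons /=.
  by have := len_sgenM i (wprod a); have /eqP -> := ra; lia.
move=> /len_sgenM_desc l.
case: (wprod_surj (sgen i * wprod a)%g) => b sb pb.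
exists [::], i, b; apply: braid_cons.
apply: matsumoto => //=; first by have /eqP -> := ra; rewrite l sb.
by rewrite wprod_cons pb sgenK.
Qed.

(** * Words in the nilCoxeter algebra *)

Definition uword a : nilA k := \prod_(i <- a) ngen i.

Lemma uword_nil : uword [::] = 1.
Proof. exact: big_nil. Qed.

Lemma uword_cat a b : uword (a ++ b) = uword a * uword b.
Proof. exact: big_cat. Qed.

Lemma uword_cons i a : uword (i :: a) = ngen i * uword a.
Proof. exact: big_cons. Qed.

Lemma fword2 i j : fword [:: i; j] = fgen i * fgen j.
Proof. by rewrite !fgenE (fwordM [:: i]). Qed.

Lemma fword3 i j l : fword [:: i; j; l] = fgen i * fgen j * fgen l.
Proof. by rewrite !fgenE (fwordM [:: i]) (fwordM [:: i; j]). Qed.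

Lemma uword_sqr i : uword [:: i; i] = 0.
Proof.
have -> : (0 : nilA k) = ncls 0 by rewrite /ncls raddf0.
by rewrite /uword nword_prod fword2; apply/nclsP; rewrite subr0; apply: nil_sqr.
Qed.

Lemma uword_swap i j : ~~ adj i j -> uword [:: i; j] = uword [:: j; i].
Proof.
by move=> ij; rewrite /uword !nword_prod !fword2; apply/nclsP/nil_comm.
Qed.

Lemma uword_move i j : (1 < k)%N -> i != j -> adj i j ->
  uword [:: i; j; i] = uword [:: j; i; j].
Proof.
move=> k1 ij aij; rewrite /uword !nword_prod !fword3.
exact/nclsP/nil_braid.
Qed.

Lemma uword_braid a b : braid a b -> uword a = uword b.
Proof.
elim=> {a b} [a|a b c _ -> _ ->|p i j q ij|p i j q k1 ij aij] //.
- by rewrite !(uword_cat p) !(uword_cat _ q) (uword_swap ij).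
- by rewrite !(uword_cat p) !(uword_cat _ q) (uword_move k1 ij aij).
Qed.

Lemma uwordE a : uword a = if is_red a then nil_elt (wprod a) else 0.
Proof.
case: ifPn => [ra|/nonred_braid[p [i [q /uword_braid ->]]]].
  have /andP[/eqP sr /eqP wr] := redwordP (wprod a).
  apply: uword_braid; apply: matsumoto => //.
  by rewrite sr; have /eqP <- := ra.
by rewrite !uword_cat uword_sqr mul0r mulr0.
Qed.

End Matsumoto.

(** * The down operator on words *)

Section DownWords.

Variable k : nat.

Local Notation I := 'I_k.+1.
Local Notation W := (affW k).
Implicit Types (a b c p q : seq I) (i j : I) (u v w x y t : W).
Implicit Types (L M : 'cV[int]_k.+1).

(* The action of the group on weights, modulo the null root. *)
Definition act_weight x L : 'cV[int]_k.+1 :=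
  \col_i pair_weight (act_coroot x^-1 (alphav i)) L.

Lemma act_coroot_sum x (mu : 'rV[int]_k.+1) :
  act_coroot x mu = \sum_i mu 0 i *: act_coroot x (alphav i).
Proof.
rewrite act_coroot_tr [in LHS](row_sum_delta mu) !linear_sum /=.
by apply: eq_bigr => i _; rewrite !linearZ /= act_coroot_tr.
Qed.

Lemma pair_act_weight (mu : 'rV[int]_k.+1) x L :
  pair_weight mu (act_weight x L) = pair_weight (act_coroot x^-1 mu) L.
Proof.
rewrite act_coroot_sum /pair_weight mulmx_suml summxE mxE.
by apply: eq_bigr => i _; rewrite -scalemxAl [RHS]mxE mxE.
Qed.

Lemma pair_alphav i L : pair_weight (alphav i) L = L i 0.
Proof. by rewrite /pair_weight -rowE mxE. Qed.

Lemma act_weightE x L i :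
  act_weight x L i 0 = pair_weight (act_coroot x^-1 (alphav i)) L.
Proof. exact: mxE. Qed.

Lemma act_weightM x y L :
  act_weight (x * y)%g L = act_weight x (act_weight y L).
Proof.
apply/matrixP => i j; rewrite ord1 !act_weightE pair_act_weight.
by rewrite -act_corootM invgM.
Qed.

Lemma act_weight1 L : act_weight 1%g L = L.
Proof.
apply/matrixP => i j; rewrite ord1 act_weightE invg1 act_coroot_tr act_root1.
by rewrite trmxK pair_alphav.
Qed.

Lemma act_weight_is_linear x : linear (act_weight x).
Proof.
move=> n L M; apply/matrixP => i j; rewrite ord1 !mxE /pair_weight.
by rewrite mulmxDr -scalemxAr !mxE.
Qed.

HB.instance Definition _ x := GRing.isLinear.Build int
  'cV[int]_k.+1 'cV[int]_k.+1 *:%R (act_weight x) (act_weight_is_linear x).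

Lemma act_weight_sgen i L j :
  act_weight (sgen i) L j 0 = L j 0 - cartan j i * L i 0.
Proof.
rewrite act_weightE sgenV act_coroot_sgen /refl_coroot pair_rootE.
by rewrite -(pair_alphav j) -(pair_alphav i) /pair_weight mulmxBl -scalemxAl !mxE.
Qed.

(** The sum over deletions of one letter, in recursive form; it makes sense for every word, so it
    can be cut at any place. *)
Fixpoint down_word L a : nilA k :=
  if a is i :: q
  then (act_weight (wprod q) L i 0)%:~R *: uword q + ngen i * down_word L q
  else 0.

(** A twisted Leibniz rule: a letter deleted from [p] sees [q] only through its action on the
    weight. *)
Lemma down_word_cat L p q : down_word L (p ++ q) =
  down_word (act_weight (wprod q) L) p * uword q + uword p * down_word L q.
Proof.
elim: p => [|i p IH] /=; first by rewrite mul0r add0r uword_nil mul1r.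
rewrite IH wprod_cat act_weightM uword_cat mulrDr mulrDl addrA.
by rewrite -scalerAl !mulrA uword_cons.
Qed.

Lemma down_word_linear n L M a :
  down_word (n *: L + M) a = n%:~R *: down_word L a + down_word M a.
Proof.
elim: a => [|i a IH] /=; first by rewrite scaler0 addr0.
rewrite IH linearP /= !mxE intrD intrM scalerDl -scalerA.
by rewrite mulrDr scalerDr -scalerAr addrACA.
Qed.

Lemma down_word1 L i : down_word L [:: i] = (L i 0)%:~R%:A.
Proof.
by rewrite /= wprod_nil act_weight1 uword_nil mulr0 addr0.
Qed.

Lemma down_word2 L i j : down_word L [:: i; j] =
  (act_weight (sgen j) L i 0)%:~R *: uword [:: j] + (L j 0)%:~R *: uword [:: i].
Proof.
rewrite (down_word_cat L [:: i] [:: j]) !down_word1 wprod1.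
by rewrite mulr_algl mulr_algr.
Qed.

(** The two deletions cancel because [s_i] negates [alphav i]. *)
Lemma down_word_sqr L i : down_word L [:: i; i] = 0.
Proof.
rewrite down_word2 -scalerDl -intrD act_weight_sgen /cartan eqxx.
by rewrite (_ : _ + _ = 0) ?scale0r //; ring.
Qed.

Hypothesis hk : (0 < k)%N.

Lemma down_word_swap L i j : ~~ adj i j ->
  down_word L [:: i; j] = down_word L [:: j; i].
Proof.
have [->//|ij nij] := eqVneq i j; have cij := cartan_nonadj ij nij.
by rewrite !down_word2 !act_weight_sgen (cartanC j i) cij !mul0r !subr0 addrC.
Qed.

(** Deleting the middle letter leaves a square, which vanishes; the two outer deletions give an
    expression symmetric in [i] and [j]. *)
Lemma down_word_move L i j : (1 < k)%N -> i != j -> adj i j ->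
  down_word L [:: i; j; i] = down_word L [:: j; i; j].
Proof.
move=> k1 ij aij.
have down3 (i1 j1 : I) : i1 != j1 -> adj i1 j1 -> down_word L [:: i1; j1; i1] =
    (L j1 0)%:~R *: uword [:: j1; i1] + (L i1 0)%:~R *: uword [:: i1; j1].
  move=> ij1 aij1; rewrite (down_word_cat L [:: i1] [:: j1; i1]) down_word1.
  rewrite mulr_algl down_word2 [in X in _ + X]mulrDr -[in X in _ + X]scalerAr.
  rewrite -[uword [:: i1] * (_ *: _)]scalerAr -!uword_cat uword_sqr scaler0 add0r.
  congr (_%:~R *: _ + _); rewrite wprod_cons wprod1 act_weightM !act_weight_sgen.
  by rewrite (cartanC j1 i1) (cartan_adj k1 ij1 aij1) /cartan eqxx; ring.
by rewrite !down3 1?addrC // 1?eq_sym // adjC.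
Qed.

Lemma down_word_braid L a b : braid a b -> down_word L a = down_word L b.
Proof.
elim=> {a b} [a|a b c _ -> _ ->|p i j q ij|p i j q k1 ij aij] //;
  rewrite !(down_word_cat _ p) !(down_word_cat _ _ q) !wprod_cat !uword_cat.
- have e : wprod [:: i; j] = wprod [:: j; i].
    by rewrite !wprod_cons wprod_nil !mulg1 sgen_comm.
  by rewrite e (uword_swap ij) (down_word_swap _ ij).
- have e : wprod [:: i; j; i] = wprod [:: j; i; j].
    by rewrite !wprod_cons wprod_nil !mulg1 !mulgA sgen_braid.
  by rewrite e (uword_move k1 ij aij) (down_word_move _ k1 ij aij).
Qed.

Lemma down_word_nonred L a : ~~ is_red a -> down_word L a = 0.
Proof.
move=> /(nonred_braid hk)[p [i [q /down_word_braid ->]]].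
rewrite !down_word_cat uword_cat uword_sqr down_word_sqr.
by rewrite !(mul0r, mulr0, addr0).
Qed.

(** Deleting a letter is right multiplication by its reflection, and the shorter word survives
    exactly when the length drops by one. The prefix [p] keeps the whole word fixed while the
    induction moves along it. *)
Lemma down_word_reflist L p a : is_red (p ++ a) -> let w := wprod (p ++ a) in
  uword p * down_word L a = \sum_(t <- reflist a)
    if len w == (len (w * t)).+1
    then (pair_weight (cover_coroot (w * t)%g w) L)%:~R *: nil_elt (w * t)%g
    else 0.
Proof.
move=> + w; elim: a p @w => [|i q IH] p w ra /=.
  by rewrite mulr0 big_nil.
rewrite mulrDr big_cons -scalerAr -uword_cat.
congr (_ + _); last first.
  rewrite mulrA /w -cat_rcons -IH ?cat_rcons // -cats1.
  by rewrite uword_cat uword_cons uword_nil mulr1.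
have lw : len w = size (p ++ i :: q) by have /eqP := ra.
have e : (w * (sgen i ^ wprod q) = wprod (p ++ q))%g.
  rewrite /w !wprod_cat wprod_cons -!mulgA; congr (_ * _)%g.
  by rewrite -conjgC sgenK.
rewrite e uwordE // lw size_cat /= addnS -size_cat eqSS -/(is_red _).
case: ifP => _; last exact: scaler0.
rewrite (@cover_corootE _ hk _ _ q i) ?act_weightE //.
  by rewrite -e invgM mulgVK -conjVg sgenV.
exact: is_red_catr ra.
Qed.

(** For a reduced word, strong exchange shows that its reflections reach every cover, and their
    distinctness that each is reached once. On a nonreduced word both sides vanish. *)
Lemma down_uword L a : down L (uword a) = down_word L a.
Proof.
rewrite uwordE //; case: ifPn => [ra|/down_word_nonred ->]; last exact: linear0.
set w := wprod a.
rewrite -[RHS]mul1r -uword_nil (@down_word_reflist L [::]) //.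
rewrite down_elt cat0s -/w.
rewrite -big_mkcond -big_filter; set r := [seq t <- _ | _].
have ur : uniq [seq (w * t)%g | t <- r].
  by rewrite map_inj_uniq ?filter_uniq ?reflist_uniq //; apply: mulgI.
rewrite -(big_map (fun t => w * t)%g xpredT
  (fun v => (pair_weight (cover_coroot v w) L)%:~R *: nil_elt v)).
rewrite (fsbig_seq _ _ ur); apply: eq_fsbigl; apply/seteqP; split=> v /=.
  move=> [lw [u [i e]]].
  have et : (w^-1 * v = sgen i ^ u^-1)%g.
    apply: invg_inj; rewrite -conjVg sgenV invgM invgK e conjgE invgK mulgA.
    done.
  have ev : (v = w * (sgen i ^ u^-1))%g by rewrite -et mulVKg.
  apply/mapP; exists (sgen i ^ u^-1)%g => //.
  rewrite mem_filter -ev lw eqxx; apply: strong_exchange.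
  by rewrite -/w -ev lw.
case/mapP => t; rewrite mem_filter => /andP[/eqP lw /mem_reflist].
move=> [p [i [q [_ et _]]]] ->; split=> //.
exists (wprod q)^-1%g, i; rewrite invgM mulgVK et -conjVg sgenV conjgE invgK.
by rewrite mulgA.
Qed.

End DownWords.

(** * Cyclically decreasing words *)

Section CyclicallyDecreasing.

Variable k : nat.
Hypothesis hk : (0 < k)%N.

Local Notation I := 'I_k.+1.
Local Notation W := (affW k).
Implicit Types (a b c p q : seq I) (i j x y z : I) (u v w t : W).
Implicit Types (S T : {set I}).

Lemma val_iter_ordS r i : val (iter r (@ordS k.+1) i) = ((i + r) %% k.+1)%N.
Proof.
elim: r => [|r IH] /=; first by rewrite addn0 modn_small.
by rewrite [nat_of_ord _]IH -[(_ %% _).+1]addn1 modnDml addn1 addnS.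
Qed.

Lemma ordS_orbit i j : exists2 r, (r <= k)%N & iter r (@ordS k.+1) i = j.
Proof.
(* This is [j - i] modulo [k + 1], arranged to avoid truncated subtraction. *)
exists ((j + (k.+1 - i)) %% k.+1)%N; first by rewrite -ltnS ltn_pmod.
apply: val_inj; rewrite val_iter_ordS modnDmr addnCA subnKC; last exact: ltnW.
by rewrite modnDr modn_small.
Qed.

(** The condition that [dec_elt] imposes on all reduced words, stated for a single word. *)
Definition cyc_dec S a : Prop := [/\ uniq a, a =i S &
  forall j, j \in S -> ordS j \in S -> (index (ordS j) a < index j a)%N].

Lemma index_mid p y q : y \notin p -> index y (p ++ y :: q) = size p.
Proof. by move=> /negPf yp; rewrite index_cat yp /= eqxx addn0. Qed.

Lemma cyc_dec_del S p i q :
  cyc_dec S (p ++ i :: q) -> cyc_dec (S :\ i) (p ++ q).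
Proof.
have pm : perm_eq (p ++ i :: q) (i :: p ++ q) by rewrite -cat1s perm_catCA.
move=> [ua aS ord].
have := ua; rewrite (perm_uniq pm) /= => /andP[ia upq].
split=> // [j|j].
  rewrite in_setD1 -aS (perm_mem pm) inE.
  by have [->|] := eqVneq j i; rewrite ?(negPf ia).
rewrite !in_setD1 => /andP[ji jS] /andP[sji sjS]; have := ord j jS sjS.
rewrite !index_cat /= 2![i == _]eq_sym (negPf ji) (negPf sji).
have := index_mem j p; have := index_mem (ordS j) p.
move: (index j p) (index (ordS j) p) (index j q) (index (ordS j) q) (size p).
by case: (j \in p); case: (ordS j \in p) => n1 n2 n3 n4 n5; clear; lia.
Qed.

(** If [i] were a left descent of [wprod a], the root [(wprod a)^-1 (alpha i)] would be nonpositive,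
    but reflections in other letters keep its coordinate at [i] equal to 1. *)
Lemma uniq_is_red a : uniq a -> is_red a.
Proof.
elim: a => [|i a IH] /=; first by rewrite /is_red wprod_nil len1.
move=> /andP[ia /IH ra].
have [lt|/len_sgenM_desc l] := boolP (len (wprod a) < len (sgen i * wprod a))%N.
  rewrite /is_red wprod_cons eq_sym eqn_leq -wprod_cons len_le /= wprod_cons.
  by have /eqP -> := ra.
have /(desc_negroot hk) /(_ i) : (len (sgen i * wprod a) < len (wprod a))%N by lia.
suff -> : (- act_root (wprod a)^-1 (alpha i)) i 0 = -1 by [].
rewrite mxE -wprod_rev; congr (- _).
have : i \notin rev a by rewrite mem_rev.
elim: (rev a) => [|y b IHb]; first by rewrite wprod_nil act_root1 alphaE eqxx.
rewrite inE negb_or => /andP[iy /IHb e].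
rewrite wprod_cons act_rootM act_root_sgen /refl_root mxE e !mxE.
by rewrite (negPf iy) mulr0 subr0.
Qed.

(** A braid move requires a repeated letter, and a commutation exchanges letters whose order is
    unconstrained. *)
Lemma cyc_dec_braid S a b : braid a b -> cyc_dec S a -> cyc_dec S b.
Proof.
elim=> {a b} // [a b c _ IH1 _ IH2 /IH1/IH2 //|p i j q ij
  |p i j q _ _ _]; last first.
  by case; rewrite cat_uniq /= !inE eqxx /= !orbT !andbF.
have pm : perm_eq (p ++ [:: i; j] ++ q) (p ++ [:: j; i] ++ q).
  by rewrite perm_cat2l perm_cat2r (perm_catC [:: i] [:: j]).
move=> [ua aS ord]; split=> [|z|z zS szS].
- by rewrite -(perm_uniq pm).
- by rewrite -(perm_mem pm).
have nij : i != j.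
  by apply/eqP => e; move: ua; rewrite cat_uniq /= !inE e eqxx /= !andbF.
have excl (x1 x2 y1 y2 : I) : (x1 = y1 -> x2 = y2 -> False) ->
    ~~ ((x1 == y1) && (x2 == y2)).
  by move=> h; apply/negP => /andP[/eqP e1 /eqP e2]; apply: h.
(* These facts exclude the impossible coincidences among [i], [j], [z] and [ordS z]; arithmetic on
   positions settles the others. *)
have h1 : ~~ ((i == z) && (j == ordS z)).
  by apply: excl => e1 e2; case/negP: ij; rewrite /adj e1 e2 eqxx orbT.
have h2 : ~~ ((j == z) && (i == ordS z)).
  by apply: excl => e1 e2; case/negP: ij; rewrite /adj e1 e2 eqxx.
have h3 (l : I) : ~~ ((l == z) && (l == ordS z)).
  by apply: excl => -> /eqP; rewrite ordS_neq.
have h4 (l : I) : ~~ ((i == l) && (j == l)).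
  by apply: excl => e1 e2; case/eqP: nij; rewrite e1.
have := ord z zS szS.
rewrite !index_cat /= !inE !(eq_sym z) !(eq_sym (ordS z)).
move: h1 h2 (h3 i) (h3 j) (h4 z) (h4 (ordS z)).
move: (index_mem z p) (index_mem (ordS z) p).
move: (index z p) (index (ordS z) p) (index z q) (index (ordS z) q) (size p).
case: (i == z); case: (i == ordS z); case: (j == z); case: (j == ordS z) => //=;
  case: (z \in p); case: (ordS z \in p) => //=; clear; lia.
Qed.

Lemma braid_front p x q : {in p, forall y, ~~ adj y x} ->
  braid (p ++ x :: q) (x :: p ++ q).
Proof.
elim: p => [|y p IH] px /=; first exact: braid_refl.
apply: braid_trans (braid_cons y (IH _)) _ => [z zp|].
  by apply: px; rewrite inE zp orbT.
by apply: (braid_swap [::] (p ++ q)); apply: px; rewrite inE eqxx.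
Qed.

(** The first letter [x] of [a] moves to the front of [b]: before it in [b] there is no [x + 1],
    which would have to precede [x] in [a], and no [x - 1], which must follow [x] in [b]. *)
Lemma cyc_dec_unique S a b : cyc_dec S a -> cyc_dec S b -> braid a b.
Proof.
elim: a S b => [|x a IH] S b ca cb.
  case: ca => _ aS _; case: cb => _ bS _; case: b bS => [|y b] bS.
    exact: braid_refl.
  by have := bS y; rewrite inE eqxx -aS.
have xS : x \in S by case: ca => _ <- _; rewrite inE eqxx.
have xb : x \in b by case: cb => _ -> _.
case/splitPr: xb cb => p q cb.
have h : {in p, forall y, ~~ adj y x}.
  move=> y yp; have yS : y \in S by case: cb => _ <- _; rewrite mem_cat yp.
  case: ca => ua aS orda; case: cb => ub bS ordb.
  have xp : x \notin p.
    by have := ub; rewrite cat_uniq /= negb_or => /and3P[_ /andP[]].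
  apply/negP => /orP[/eqP e|/eqP e].
    by have := orda x xS; rewrite -e yS /= eqxx => /(_ isT).
  have := ordb y yS; rewrite -e xS => /(_ isT); rewrite index_mid // index_cat yp.
  by rewrite ltnNge ltnW // index_mem.
apply: braid_trans (braid_sym (braid_front q h)).
apply/braid_cons/(IH (S :\ x)); first exact: (@cyc_dec_del S [::] x a).
exact: cyc_dec_del.
Qed.

(** A nonempty proper subset contains some [x] whose successor lies outside it, or else it would
    fill the cycle; such an [x] may stand first. *)
Lemma cyc_dec_exists S : S != setT -> exists a, cyc_dec S a.
Proof.
have [n] := ubnP #|S|; elim: n S => // n IH S Sn ST.
have [->|/set0Pn[x0 x0S]] := eqVneq S set0.
  by exists [::]; split=> // j; rewrite inE.
have [x xS sxS] : exists2 x, x \in S & ordS x \notin S.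
  have [/existsP[x /andP[xS sxS]]|/existsPn h] :=
    boolP [exists x, (x \in S) && (ordS x \notin S)]; first by exists x.
  case/eqP: ST; apply/setP => y; rewrite in_setT.
  have [r _ <-] := ordS_orbit x0 y; elim: r => //= r IHr.
  by have := h (iter r (@ordS k.+1) x0); rewrite IHr negbK.
have [||a [ua aS ord]] := IH (S :\ x).
- by move: Sn; rewrite (cardsD1 x S) xS.
- by apply/eqP => e; have := in_setT x; rewrite -e in_setD1 eqxx.
exists (x :: a); split=> [|j|j jS sjS] /=.
- by rewrite ua andbT aS in_setD1 eqxx.
- by rewrite inE aS in_setD1; case: (eqVneq j x) => [->|].
have [e|xj] := eqVneq x j; first by case/negP: sxS; rewrite e.
have [e|xsj] := eqVneq x (ordS j) => //.
by rewrite ltnS; apply: ord; rewrite in_setD1 1?eq_sym ?xj ?xsj.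
Qed.

(** Reduced words of [wprod a] are braid equivalent to [a], hence cyclically decreasing, so the
    default of [xget] is never taken; uniqueness then identifies the products. *)
Lemma dec_eltE S a : cyc_dec S a -> nil_elt (dec_elt S) = uword a.
Proof.
move=> ca; have [ua aS _] := ca.
have red_cyc b : reduced_word (wprod a) b -> cyc_dec S b.
  move=> /andP[/eqP sb /eqP wb]; apply: cyc_dec_braid ca.
  apply: matsumoto => //; first exact: uniq_is_red.
  by rewrite sb; have /eqP <- := uniq_is_red ua.
pose P (w : W) := forall b, reduced_word w b -> perm_eq b (enum S) /\
  forall j, j \in S -> ordS j \in S -> (index (ordS j) b < index j b)%N.
have : P (dec_elt S).
  rewrite /dec_elt; case: xgetP => [w -> //|/(_ (wprod a)) []] b /red_cyc.
  case=> ub bS ord; split=> //; apply: uniq_perm; rewrite ?enum_uniq // => j.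
  by rewrite bS mem_enum.
move=> /(_ _ (redwordP _)) [pb ordb].
apply: uword_braid; apply: (@cyc_dec_unique S) => //; split=> // [|j].
  by rewrite (perm_uniq pb) enum_uniq.
by rewrite (perm_mem pb) mem_enum.
Qed.

(** In other words, the root is the sum of the simple roots over the longest cyclic interval of [S]
    ending at [i]. The induction appends letters to [q]. *)
Lemma cyc_dec_root S p i q : cyc_dec S (p ++ i :: q) ->
  let be := act_root (wprod q)^-1 (alpha i) in
  [/\ be i 0 = 1,
      forall y, y \in S -> y != i -> be y 0 = be (ordS y) 0
    & forall y, y \notin S -> be y 0 = 0].
Proof.
(* The predecessor of the last letter is outside the set, since it would have to come later
   still. *)
have last_ord T a y z : cyc_dec T (rcons a y) -> z \in T -> ordS z != y.
  case=> ua aT ord zT; apply/eqP => e.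
  have zy : z == y = false by rewrite -e ordS_neq.
  have yT : y \in T by rewrite -aT mem_rcons inE eqxx.
  have za : z \in a by have := aT z; rewrite zT mem_rcons inE zy.
  have := ord z zT; rewrite e yT -cats1 !index_cat za => /(_ isT).
  have := ua; rewrite rcons_uniq => /andP[/negPf -> _] /=.
  by rewrite eqxx addn0 ltnNge ltnW // index_mem.
elim/last_ind: q S => [|q y IH] S cS /=.
  rewrite wprod_nil invg1 act_root1; split=> [|y yS yi|y yS].
  - by rewrite alphaE eqxx.
  - rewrite !alphaE (negPf yi); have : ordS y != i.
      by apply: (last_ord S p i) => //; rewrite -cats1.
    by move/negPf->.
  - rewrite alphaE; case: eqP => // e; case/negP: yS; case: cS => _ <- _.
    by rewrite e mem_cat inE eqxx orbT.
have lst z : z \in S -> ordS z != y.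
  by apply: (last_ord S (p ++ i :: q)); rewrite rcons_cat rcons_cons.
have cS' : cyc_dec (S :\ y) (p ++ i :: q).
  rewrite -[p ++ _]cats0; apply: cyc_dec_del; rewrite -catA /= cats1.
  exact: cS.
have [b1 b2 b3] := IH _ cS'.
have yS : y \in S.
  by case: cS => _ <- _; rewrite mem_cat inE mem_rcons inE eqxx !orbT.
have iy : i != y.
  by case: cS' => _ /(_ i); rewrite mem_cat !inE eqxx orbT => /esym/andP[].
rewrite -cats1 wprod_cat wprod1 invgM sgenV act_rootM act_root_sgen.
move: b1 b2 b3; set be := act_root _ _ => b1 b2 b3.
(* The coefficients at [y] and at its predecessor vanish, so the reflection copies the coefficient
   of [ordS y] to [y]. *)
have bE z : refl_root y be z 0 = if z == y then be (ordS y) 0 else be z 0.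
  rewrite /refl_root 3!mxE alphaE.
  case: eqP => [->|_]; last by rewrite mulr0 subr0.
  rewrite pair_root_alphav // b3 ?in_setD1 ?eqxx // (b3 (ord_pred y)); last first.
    rewrite in_setD1 negb_and; apply/orP; right; apply/negP => /lst.
    by rewrite ord_predK eqxx.
  by rewrite mul0r !sub0r mulr1 opprK.
split=> [|z zS zi|z zS].
- by rewrite bE (negPf iy).
- rewrite !bE (negPf (lst z zS)); case: eqP => [->//|/eqP zy].
  by apply: b2; rewrite ?in_setD1 ?zy.
- rewrite bE; case: eqP => [e|_]; first by rewrite e yS in zS.
  by apply: b3; rewrite in_setD1 (negPf zS) andbF.
Qed.

(* The first element outside T met when going up from j. *)
Definition next_out T j : I :=
  iter (find (fun r => iter r (@ordS k.+1) j \notin T) (iota 0 k.+1))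
    (@ordS k.+1) j.

Lemma next_outP T j : T != setT ->
  exists2 r, next_out T j = iter r (@ordS k.+1) j
  & iter r (@ordS k.+1) j \notin T /\
    forall s, (s < r)%N -> iter s (@ordS k.+1) j \in T.
Proof.
move=> TT; have [x xT] : exists x, x \notin T.
  apply/existsP; apply: contraNT TT => /existsPn h; apply/eqP/setP => y.
  by rewrite in_setT; have := h y; rewrite negbK.
pose P r := iter r (@ordS k.+1) j \notin T.
pose r := find P (iota 0 k.+1); exists r => //.
have hP : has P (iota 0 k.+1).
  have [s sk e] := ordS_orbit j x; apply/hasP; exists s.
    by rewrite mem_iota.
  by rewrite /P e.
have rk : (r < k.+1)%N by move: (hP); rewrite has_find size_iota.
split; first by have := nth_find 0%N hP; rewrite nth_iota.
move=> s sr; have := before_find 0%N sr.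
by rewrite nth_iota ?(ltn_trans sr) // => /negbFE.
Qed.

(** Going up from [j] inside [T] the coefficient is constant; at the exit it is 1 if the exit is [i]
    and 0 otherwise. *)
Lemma next_out_root T i j (be : 'cV[int]_k.+1) : T != setT -> be i 0 = 1 ->
  (forall y, y \in T -> be y 0 = be (ordS y) 0) ->
  (forall y, y \notin T -> y != i -> be y 0 = 0) ->
  be j 0 = (next_out T j == i)%:R.
Proof.
move=> TT b1 b2 b3; have [r -> [rT sT]] := next_outP j TT.
have e s : (s <= r)%N -> be j 0 = be (iter s (@ordS k.+1) j) 0.
  elim: s => // s IH sr; rewrite IH 1?ltnW //= b2 //; exact: sT.
rewrite (e r) //; case: eqP => [->//|/eqP ni]; exact: b3.
Qed.

Lemma down_word_cyc_dec j S p a : S != setT -> cyc_dec S (p ++ a) ->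
  uword p * down_word (fund j) a =
  \sum_(i <- a) (next_out (S :\ i) j == i)%:R *: nil_elt (dec_elt (S :\ i)).
Proof.
move=> ST; elim: a p => [|i q IH] p cS /=; first by rewrite mulr0 big_nil.
rewrite mulrDr big_cons -scalerAr -uword_cat; congr (_ + _); last first.
  rewrite mulrA -(IH (rcons p i)) ?cat_rcons //.
  by rewrite -cats1 uword_cat uword_cons uword_nil mulr1.
rewrite (dec_eltE (cyc_dec_del cS)) act_weightE; congr (_ *: _).
have [b1 b2 b3] := cyc_dec_root cS.
have iS : i \in S by case: cS => _ <- _; rewrite mem_cat inE eqxx orbT.
rewrite act_coroot_tr alphav_tr /pair_weight -colE !mxE.
rewrite (next_out_root (T := S :\ i) (i := i) j _ b1) ?rmorph_nat //.
- by apply/eqP => e; have := in_setT i; rewrite -e in_setD1 eqxx.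
- by move=> y; rewrite in_setD1 => /andP[yi yS]; apply: b2.
- by move=> y; rewrite in_setD1 negb_and negbK => /orP[/eqP ->|yS _];
    [rewrite eqxx | apply: b3].
Qed.

Lemma down_hgen_fund j m : (m < k)%N -> down (fund j) (hgen k m.+1) = hgen k m.
Proof.
move=> mk; rewrite /hgen linear_sum /=.
pose F i T : nilA k := (next_out T j == i)%:R *: nil_elt (dec_elt T).
have card_proper S : (#|S| <= k)%N -> S != setT.
  by apply: contraTneq => ->; rewrite cardsT card_ord ltnn.
transitivity (\sum_(S : {set I} | #|S| == m.+1) \sum_(i in S) F i (S :\ i)).
  apply: eq_bigr => S /eqP Sm.
  have ST : S != setT by apply: card_proper; rewrite Sm.
  have [a ca] := cyc_dec_exists ST; have [ua aS _] := ca.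
  rewrite (dec_eltE ca) down_uword // -[LHS]mul1r -uword_nil.
  rewrite (down_word_cyc_dec j (p := [::]) ST ca).
  rewrite -[RHS]big_enum; apply: perm_big.
  by apply: uniq_perm; rewrite ?enum_uniq // => i; rewrite aS mem_enum.
rewrite (exchange_big_dep xpredT) //=.
(* For fixed [i], the sets containing [i] are the [i |: T] with [i] outside [T]. *)
transitivity (\sum_i \sum_(T : {set I} | (#|T| == m) && (i \notin T)) F i T).
  apply: eq_bigr => i _.
  rewrite (reindex_onto (fun T => i |: T) (fun S => S :\ i)) /=; last first.
    by move=> S /andP[_ iS]; rewrite setD1K.
  apply: eq_big => [T|T /andP[_ /eqP -> //]].
  have [iT|iT] := boolP (i \in T).
    rewrite andbF; apply/negbTE; rewrite negb_and; apply/orP; right.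
    by apply: contraL iT => /eqP <-; rewrite in_setD1 eqxx.
  by rewrite setU1K // eqxx cardsU1 iT add1n eqSS setU11 !andbT.
rewrite (exchange_big_dep (fun T : {set I} => #|T| == m)) /=; last first.
  by move=> i T _ /andP[].
apply: eq_bigr => T /eqP Tm.
(* As [T] has fewer than [k] elements, the upward walk from [j] leaves it, and only the exit point
   contributes. *)
have TT : T != setT by apply: card_proper; rewrite Tm ltnW.
have [r er [rT _]] := next_outP j TT.
rewrite (bigD1 (next_out T j)) /=; last by rewrite Tm eqxx er.
rewrite /F eqxx scale1r big1 ?addr0 // => i /andP[_ ni].
by rewrite eq_sym (negPf ni) scale0r.
Qed.

End CyclicallyDecreasing.

(** * The Leibniz rule *)

Section Derivation.

Variable k : nat.
Hypothesis hk : (0 < k)%N.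

Local Notation I := 'I_k.+1.
Implicit Types (a q : seq I) (i j : I) (x y : nilA k).
Implicit Types (L M : 'cV[int]_k.+1).

Lemma uword_ind (P : nilA k -> Prop) :
  P 0 -> (forall (c : rat) a x, P x -> P (c *: uword a + x)) -> forall x, P x.
Proof.
move=> P0 PS x; rewrite -(ncls_repr x) (malg_sum_words (repr x)).
elim: (enum_fset _) => [|m r IH]; first by rewrite big_nil /ncls raddf0.
by rewrite big_cons nclsD nclsZ -nword_prod; apply: PS.
Qed.

Lemma downD L x y : down L (x + y) = down L x + down L y.
Proof. exact: linearD. Qed.

Lemma downZ L c x : down L (c *: x) = c *: down L x.
Proof. exact: linearZ. Qed.

Lemma down0 L : down L 0 = 0.
Proof. exact: linear0. Qed.

Lemma down_weight_linear (n : int) L M x :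
  down (n *: L + M) x = n%:~R *: down L x + down M x.
Proof.
elim/uword_ind: x => [|c a x IH]; first by rewrite !down0 scaler0 addr0.
rewrite !downD !downZ IH !down_uword // down_word_linear !scalerDr !scalerA.
by rewrite mulrC -!addrA; congr (_ + _); rewrite addrCA.
Qed.

Lemma down_weight_sum (J : Type) (r : seq J) (n : J -> int)
    (L : J -> 'cV[int]_k.+1) x :
  down (\sum_(j <- r) n j *: L j) x = \sum_(j <- r) (n j)%:~R *: down (L j) x.
Proof.
elim: r => [|j r IH]; last by rewrite !big_cons down_weight_linear IH.
(* Linearity at coefficient 1 gives [down 0 x = down 0 x + down 0 x], which settles the empty
   sum. *)
have := down_weight_linear 1 0 0 x; rewrite !big_nil scaler0 addr0 scale1r.
by move=> /eqP; rewrite -subr_eq0 opprD addrA subrr sub0r oppr_eq0 => /eqP.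
Qed.

Lemma down_mul_word L x q : down L (x * uword q) =
  down (act_weight (wprod q) L) x * uword q + x * down L (uword q).
Proof.
elim/uword_ind: x => [|c a x IH].
  by rewrite !(mul0r, down0) addr0.
rewrite mulrDl !downD IH -scalerAl -uword_cat !downZ !down_uword //.
rewrite down_word_cat !mulrDl -!scalerAl scalerDr.
exact: addrACA.
Qed.

(* Elements on which the operator only depends on the level of the weight. *)
Definition level_inv x := forall L i, down (act_weight (sgen i) L) x = down L x.

Lemma level_inv_word x q L :
  level_inv x -> down (act_weight (wprod q) L) x = down L x.
Proof.
move=> lx; elim: q => [|i q IH]; first by rewrite wprod_nil act_weight1.
by rewrite wprod_cons act_weightM lx.
Qed.

(** By linearity [y] may be taken to be a word, and invariance of [x] removes the twist. *)
Lemma down_mul L x y : level_inv x ->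
  down L (x * y) = down L x * y + x * down L y.
Proof.
move=> lx; elim/uword_ind: y => [|c a y IH].
  by rewrite !(mulr0, down0) addr0.
rewrite mulrDr !downD IH -scalerAr !downZ down_mul_word level_inv_word //.
by rewrite !mulrDr -!scalerAr scalerDr addrACA.
Qed.

Lemma down1 L : down L 1 = 0.
Proof. by rewrite -uword_nil down_uword. Qed.

Lemma level_inv1 : level_inv 1.
Proof. by move=> L i; rewrite !down1. Qed.

Lemma level_invP c x y : level_inv x -> level_inv y -> level_inv (c *: x + y).
Proof. by move=> lx ly L i; rewrite !downD !downZ lx ly. Qed.

Lemma level_invM x y : level_inv x -> level_inv y -> level_inv (x * y).
Proof. by move=> lx ly L i; rewrite !down_mul // lx ly. Qed.

(** Expand [L] in fundamental weights, each contributing [hgen k m]; the coefficient is the level of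
    [L]. *)
Lemma down_hgen L m : (m < k)%N ->
  down L (hgen k m.+1) = (\sum_j L j 0)%:~R *: hgen k m.
Proof.
move=> mk; have {1}-> : L = \sum_j L j 0 *: fund j.
  by rewrite [LHS]matrix_sum_delta; apply: eq_bigr => j _; rewrite big_ord1.
rewrite down_weight_sum rmorph_sum scaler_suml; apply: eq_bigr => j _.
by rewrite down_hgen_fund.
Qed.

Lemma level_inv_hgen m : (1 <= m <= k)%N -> level_inv (hgen k m).
Proof.
case: m => // m mk L i; rewrite !down_hgen //; congr (_%:~R *: _).
under eq_bigr => j _ do rewrite act_weight_sgen.
by rewrite sumrB -mulr_suml cartan_sum // mul0r subr0.
Qed.

Lemma hgen0 : hgen k 0 = 1.
Proof.
rewrite /hgen (big_pred1 finset.set0) => [|S]; last by rewrite cards_eq0.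
rewrite (@dec_eltE _ hk _ [::]) ?uword_nil //.
by split=> // j; rewrite inE.
Qed.

(** * Induction and closure for the Fomin-Stanley subalgebra *)

Lemma fomin_stanley_ind (P : nilA k -> Prop) :
  P 1 -> (forall c x y, P x -> P y -> P (c *: x + y)) ->
  (forall x y, P x -> P y -> P (x * y)) ->
  (forall m, (1 <= m <= k)%N -> P (hgen k m)) ->
  forall x, fomin_stanley x -> P x.
Proof.
move=> P1 PL PM Ph x /(_ (fun y => `[< P y >])) fx; apply/asboolP/fx.
  split; first exact/asboolP.
    by move=> c y z /asboolP Py /asboolP Pz; apply/asboolP/PL.
  by move=> y z /asboolP Py /asboolP Pz; apply/asboolP/PM.
by move=> m /Ph Pm; apply/asboolP.
Qed.

Lemma fomin_stanley1 : fomin_stanley (1 : nilA k).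
Proof. by move=> B [B1 _ _] _. Qed.

Lemma fomin_stanleyP c x y :
  fomin_stanley x -> fomin_stanley y -> fomin_stanley (c *: x + y).
Proof.
by move=> fx fy B cB hB; case: (cB) => _ BL _; apply: BL; [apply: fx | apply: fy].
Qed.

Lemma fomin_stanleyM x y :
  fomin_stanley x -> fomin_stanley y -> fomin_stanley (x * y).
Proof.
by move=> fx fy B cB hB; case: (cB) => _ _ BM; apply: BM; [apply: fx | apply: fy].
Qed.

Lemma fomin_stanley_hgen m : (m <= k)%N -> fomin_stanley (hgen k m).
Proof.
case: m => [_|m mk]; first by rewrite hgen0; apply: fomin_stanley1.
by move=> B _; apply.
Qed.

Lemma fomin_stanley_level_inv x : fomin_stanley x -> level_inv x.
Proof.
apply: fomin_stanley_ind => [|c y z|y z|].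
- exact: level_inv1.
- exact: level_invP.
- exact: level_invM.
- exact: level_inv_hgen.
Qed.

Lemma fomin_stanley_down L x : fomin_stanley x -> fomin_stanley (down L x).
Proof.
have fZ c y : fomin_stanley y -> fomin_stanley (c *: y).
  (* Zero is obtained as -1 times 1 plus 1, so closure under linear combinations yields closure
     under scaling. *)
  move=> fy; have f0 := fomin_stanleyP (-1) fomin_stanley1 fomin_stanley1.
  by have := fomin_stanleyP c fy f0; rewrite scaleN1r addNr addr0.
(* Membership of [x] itself is carried along, as the product case needs it for the Leibniz rule. *)
move=> fx; suff [] : fomin_stanley x /\ fomin_stanley (down L x) by [].
elim/fomin_stanley_ind: x / fx => [|c x y|x y|[//|m] mk].
- split; first exact: fomin_stanley1.
  by rewrite down1 -(scale0r 1); apply/fZ/fomin_stanley1.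
- move=> [fx dx] [fy dy]; split; first exact: fomin_stanleyP.
  by rewrite downD downZ; apply: fomin_stanleyP.
- move=> [fx dx] [fy dy]; split; first exact: fomin_stanleyM.
  rewrite down_mul; last exact: fomin_stanley_level_inv.
  by rewrite -[_ * y]scale1r; apply: fomin_stanleyP; apply: fomin_stanleyM.
- split; first exact: fomin_stanley_hgen.
  by rewrite down_hgen //; apply/fZ/fomin_stanley_hgen/ltnW.
Qed.

End Derivation.

Theorem theorem3p9 (k : nat) (hk : (0 < k)%N) (j : 'I_k.+1) :
  (forall x y : nilA k, fomin_stanley x -> fomin_stanley y ->
     down (fund j) (x * y) = down (fund j) x * y + x * down (fund j) y) /\
  (forall x : nilA k, fomin_stanley x -> fomin_stanley (down (fund j) x)).
Proof.
split=> [x y fx _|x]; last exact: fomin_stanley_down.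
exact/down_mul/fomin_stanley_level_inv.
Qed.
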